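(* For a subsequence $(k_n)$ of $\mathbb{N}$ the following assertions (i) and (ii) are equivalent: (i) $(k_n)$ is extremal. (ii) For every complex Hilbert space $H$, every linear contraction $T$ on $H$, and every $x\in H\setminus\{0\}$, if $\lim_{n\to\infty}|(T^{k_n}x|x)|=\|x\|^2$, then $x$ is an eigenvector of $T$ with unimodular eigenvalue. Moreover, if $(k_n)$ satisfies $\liminf_{n\to\infty}(k_{n+1}-k_n)<\infty$ (for example, if $(k_n)$ has positive upper density), then assertions (i) and (ii) are also equivalent to: (iii) For every bounded linear operator $T$ on a complex Banach space $E$ and every $x\in E\setminus\{0\}$, the condition $$\lim_{n\to\infty}|\langle T^{k_n}x,x'\rangle|=|\langle x,x'\rangle|\quad\text{for every }x'\in E'$$ implies that $x$ is an eigenvector of $T$ with unimodular eigenvalue.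
   Context: $\mathbb{N}=\{1,2,\dots\}$; a subsequence $(k_n)$ of $\mathbb{N}$ is a function $k:\mathbb{N}\to\mathbb{N}$ that is strictly increasing for sufficiently large indices. Its upper density is $\limsup_{N\to\infty}\frac{|\{n:k_n\le N\}|}{N}$. For a Borel probability measure $\mu$ on the unit circle $\mathbb{T}$, $\widehat\mu(k)=\int_{\mathbb{T}}z^k\,\mathrm{d}\mu(z)$. The subsequence $(k_n)$ is called extremal if every Borel probability measure $\mu$ on $\mathbb{T}$ with $\lim_{n\to\infty}|\widehat\mu(k_n)|=1$ is a Dirac measure. $(\cdot|\cdot)$ denotes the inner product, $E'$ the dual of $E$, $\langle\cdot,\cdot\rangle$ the duality pairing. A contraction is an operator of norm at most $1$; unimodular means of absolute value $1$. *)

(* Defs.v *)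
From HB Require Import structures.
From mathcomp Require Import all_boot all_order all_algebra.
From mathcomp Require Import finmap complex.
From mathcomp Require Import all_classical all_reals all_analysis.

Set Implicit Arguments.
Unset Strict Implicit.
Unset Printing Implicit Defensive.

Import Order.TTheory GRing.Theory Num.Theory.
Import numFieldNormedType.Exports.

Local Open Scope classical_set_scope.
Local Open Scope complex_scope.
Local Open Scope ring_scope.

(* [k n] stands for the (n+1)-st term of a sequence indexed by {1, 2, ...};
   the values themselves are positive. *)
Definition subsequence (k : nat -> nat) : Prop :=
  (forall n, (0 < k n)%N) /\
  (exists n0, forall m n, (n0 <= m)%N -> (m < n)%N -> (k m < k n)%N).

(* For a subsequence, the sets whose cardinals are taken are finite
   ([fset_set] sends infinite sets to the empty one). *)
Definition upper_density (R : realType) (k : nat -> nat) : \bar R :=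
  limn_esup (fun N : nat =>
    ((#|` fset_set [set n | (k n <= N)%N]|)%:R / N%:R)%:E).

Definition liminf_gap (R : realType) (k : nat -> nat) : \bar R :=
  limn_einf (fun n : nat => ((k n.+1)%:R - (k n)%:R)%:E).

(* The topology of the complex plane [R[i]] is carried by its alias [R[i]^o];
   the circle gets the subspace topology. *)
Definition unit_circle (R : realType) : set R[i]^o := [set z | `|z| = 1].

Definition circle (R : realType) : Type := set_type (@unit_circle R).

HB.instance Definition _ (R : realType) := Topological.on (circle R).

Lemma circle1_subproof (R : realType) : (1 : R[i]^o) \in @unit_circle R.
Proof. by rewrite inE /unit_circle /= normr1. Qed.

HB.instance Definition _ (R : realType) :=
  isPointed.Build (circle R) (exist _ (1 : R[i]^o) (circle1_subproof R)).

Definition borel_circle (R : realType) :=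
  [the measurableType _ of @g_sigma_algebraType (circle R) open].

Definition circle_val (R : realType) (z : borel_circle R) : R[i] :=
  \val (z : circle R).

Definition fourier_coef (R : realType) (mu : probability (borel_circle R) R)
    (k : nat) : R[i] :=
  (\int[mu]_z complex.Re (circle_val z ^+ k)) +i*
  (\int[mu]_z complex.Im (circle_val z ^+ k)).

Definition is_dirac (R : realType) (mu : probability (borel_circle R) R) : Prop :=
  exists a : borel_circle R,
    forall A : set (borel_circle R), measurable A -> mu A = \d_a A.

Definition extremal (R : realType) (k : nat -> nat) : Prop :=
  forall mu : probability (borel_circle R) R,
    (fun n => `|fourier_coef mu (k n)| : R[i]^o) @ \oo --> (1 : R[i]^o) ->
    is_dirac mu.

Definition unimodular_eigenvector (R : realType) (E : lmodType R[i])
    (T : E -> E) (x : E) : Prop :=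
  x != 0 /\ exists lambda : R[i], `|lambda| = 1 /\ T x = lambda *: x.

(* A Hilbert space is a complete normed space [H] with an inner product [ip]
   (linear in its first argument) that induces the norm.
   Norms in a complex normed space are [R[i]]-valued. *)
Definition hilbert_property (R : realType) (k : nat -> nat) : Prop :=
  forall (H : completeNormedModType R[i]) (ip : {dot H for (@Num.conj R[i])}),
    (forall y : H, `|y| ^+ 2 = ip y y) ->
  forall T : {linear H -> H},
    (forall y : H, `|T y| <= `|y|) ->
  forall x : H, x != 0 ->
    (fun n => `|ip (iter (k n) T x) x| : R[i]^o) @ \oo -->
      (`|x| ^+ 2 : R[i]^o) ->
    unimodular_eigenvector T x.

(* For linear maps, boundedness near 0 is boundedness as an operator
   ([linear_boundedP]) and continuity ([linear_bounded_continuous]). *)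
Definition banach_property (R : realType) (k : nat -> nat) : Prop :=
  forall (E : completeNormedModType R[i]) (T : {linear E -> E}),
    bounded_near T (nbhs (0 : E)) ->
  forall x : E, x != 0 ->
    (forall x' : {linear E -> R[i]^o}, continuous x' ->
      (fun n => `|x' (iter (k n) T x)| : R[i]^o) @ \oo -->
        (`|x' x| : R[i]^o)) ->
    unimodular_eigenvector T x.

(* Main.v *)
(** (i) => (ii): for a contraction [T] and a unit vector [x], the sequence
    [n |-> (T^n x | x)] is positive definite, hence by Herglotz' theorem it is
    the sequence of Fourier coefficients of a probability measure.  By
    extremality this measure is a Dirac mass at some [a], so [(T x | x) = a]
    and the equality case of the Cauchy-Schwarz inequality gives [T x = a x].
    For Herglotz' theorem, positive definiteness yields discrete measures on the
    [N]-th roots of unity with almost the right coefficients; they are images of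
    Lebesgue measure on [[0, 1]] under [t |-> exp (2 i pi q_N(t))] with monotone
    [q_N], and a pointwise limit of the [q_N] defines the desired measure.

    (ii) => (i): apply (ii) to the multiplication by [z] on [L^2(mu)] and to
    the constant function [1].

    (iii) => (ii): with [c_n = (T^(k_n) x | x) / |x|^2], the hypothesis forces
    [T^(k_n) x - c_n x] to tend to [0] in norm, and [|c_n|] to tend to [1].

    (i) => (iii): by Hahn-Banach, [T^(k_n) x - a_n x] tends weakly to [0] for
    scalars with [|a_n|] tending to [1].  Along infinitely many [n] with
    [k_(n+1) - k_n = d] this yields [T^d x = mu x] with [|mu| = 1], so [x] is a
    sum of eigenvectors whose eigenvalues are [d]-th roots of [mu].  Two distinct
    eigenvalues [z], [w] occurring in [x] would give
    [|z^(k_n) + w^(k_n)| -> 2], which contradicts the extremality for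
    [(delta_z + delta_w) / 2]. *)
Require Import Defs.
From HB Require Import structures.
From mathcomp Require Import all_boot all_order all_algebra.
From mathcomp Require Import finmap complex sesquilinear.
From mathcomp Require Import all_classical all_reals all_analysis.
From mathcomp Require Import measurable_realfun.
From mathcomp Require Import ring lra zify.

Set Implicit Arguments.
Unset Strict Implicit.
Unset Printing Implicit Defensive.

Import Order.TTheory GRing.Theory Num.Theory.
Import numFieldNormedType.Exports.

Local Open Scope classical_set_scope.
Local Open Scope complex_scope.
Local Open Scope ring_scope.

(** * Limits and norms in the complex plane *)

Section ComplexNumbers.
Variable R : realType.

(** The order of [R[i]] is partial: comparable elements have the same imaginary part. Positive
    tolerances and norms can thus be exchanged for real numbers. *)
Lemma gt0_complexE (e : R[i]) : 0 < e -> 0 < complex.Re e /\ e = (complex.Re e)%:C.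
Proof. by case: e => a b; rewrite ltcE /= => /andP[/eqP -> a0]. Qed.

Lemma cvgCP (u : nat -> R[i]) (l : R[i]) :
  (u : nat -> R[i]^o) @ \oo --> (l : R[i]^o) <->
  forall e : R, 0 < e -> exists N, forall n, (N <= n)%N -> `|u n - l| < e%:C.
Proof.
split=> [/cvgrPdist_lt ul e e0|ul].
  have e0' : 0 < e%:C :> R[i] by rewrite ltcR.
  have [N _ uN] := ul _ e0'.
  by exists N => n Nn; rewrite distrC; exact: uN.
apply/cvgrPdist_lt => e /gt0_complexE[e0 ->]; have [N uN] := ul _ e0.
by exists N => // n Nn; rewrite /= distrC; exact: uN.
Qed.

Lemma cvgC_divr (u : nat -> R[i]) (l : R[i]) : l != 0 ->
  (u : nat -> R[i]^o) @ \oo --> (l : R[i]^o) ->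
  ((fun n => u n / l) : nat -> R[i]^o) @ \oo --> (1 : R[i]^o).
Proof.
move=> l0 /cvgCP ul; apply/cvgCP => e e0.
have [l0' lE] : 0 < complex.Re `|l| /\ `|l| = (complex.Re `|l|)%:C.
  by apply: gt0_complexE; rewrite normr_gt0.
have [N uN] := ul _ (mulr_gt0 e0 l0').
exists N => n /uN; rewrite rmorphM /= -lE -ltr_pdivrMr ?normr_gt0// -normf_div.
by rewrite mulrBl divff.
Qed.

Lemma cvgC_sqr (u : nat -> R[i]) (l : R[i]) :
  (u : nat -> R[i]^o) @ \oo --> (l : R[i]^o) ->
  ((fun n => u n ^+ 2) : nat -> R[i]^o) @ \oo --> (l ^+ 2 : R[i]^o).
Proof. move=> ul; exact: (cvgM ul ul). Qed.

Lemma normc_real (r : R) : `|r%:C| = `|r|%:C.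
Proof. by rewrite normc_def /= expr0n addr0 sqrtr_sqr. Qed.

Lemma norm_i : `|'i : R[i]| = 1.
Proof. by rewrite normc_def /= expr0n expr1n add0r sqrtr1. Qed.

End ComplexNumbers.

(** * Upper density and gaps *)

Lemma subsequence_gap_tail (k : nat -> nat) G n0 :
  (forall n, (n0 <= n)%N -> (k n + G <= k n.+1)%N) ->
  forall j, (G * j <= k (n0 + j))%N.
Proof.
move=> kG; elim=> [|j IH]; first by rewrite muln0.
rewrite addnS mulnS; have := kG (n0 + j)%N (leq_addr _ _); lia.
Qed.

(** Beyond [n0] the terms grow at least linearly with slope [G], so all the indices counted lie
    below [n0 + (N %/ G).+1]. *)
Lemma card_subsequence_le (k : nat -> nat) G n0 N : (0 < G)%N ->
  (forall n, (n0 <= n)%N -> (k n + G <= k n.+1)%N) ->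
  (#|` fset_set [set n | (k n <= N)%N]| <= n0 + (N %/ G).+1)%N.
Proof.
move=> G0 kG; apply: geq_card_fset_set; apply: subset_card_le => n /= knN.
have [nn0|n0n] := ltnP n n0; first by rewrite ltn_addr.
have := subsequence_gap_tail kG (n - n0); rewrite subnKC// => h.
have : (n - n0 <= N %/ G)%N by rewrite leq_divRL// mulnC (leq_trans h).
by rewrite -ltnS ltn_subLR.
Qed.

(** Combinatorial form of the gap condition. If every [G] is eventually a lower bound of the gaps,
    the gaps tend to infinity; conversely, a gap smaller than [G] in every tail bounds all tail
    infima by [G]. *)
Lemma liminf_gap_ltyP (R : realType) (k : nat -> nat) :
  (liminf_gap R k < +oo)%E <->
  exists G, forall N, exists2 n, (N <= n)%N & (k n.+1 < k n + G)%N.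
Proof.
split=> [|[G kG]].
  apply: contraPP => /forallNP kG; apply/negP; rewrite -leNgt leye_eq.
  apply/eqP; rewrite /liminf_gap.
  suff /cvg_limn_einf_sup[] :
    (fun n : nat => ((k n.+1)%:R - (k n)%:R : R)%:E) @ \oo --> +oo%E by [].
  apply/cvgeryP/cvgryPge => A.
  have [N kN] : exists N, forall n, (N <= n)%N -> (k n + (Num.trunc A).+1 <= k n.+1)%N.
    have := kG (Num.trunc A).+1; move=> /existsNP[N] /forall2NP kN.
    by exists N => n Nn; have [|/negP] := kN n; [|rewrite -leqNgt].
  exists N => // n /= /kN h; rewrite lerBrDl.
  apply: (@le_trans _ _ ((k n)%:R + (Num.trunc A).+1%:R)).
    by rewrite lerD2l ltW// truncnS_gt.
  by rewrite -natrD ler_nat.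
apply: (@le_lt_trans _ _ (G%:R : R)%:E); last exact: ltry.
rewrite /liminf_gap limn_einf_lim; apply: lime_le.
  exact: is_cvg_einfs.
near=> N; have [n Nn kn] := kG N.
apply: (@le_trans _ _ ((k n.+1)%:R - (k n)%:R : R)%:E).
  by apply: ereal_inf_lbound; exists n.
by rewrite lee_fin lerBlDl -natrD ler_nat ltnW.
Unshelve. all: by end_near. Qed.

(** By contraposition: if the gaps tend to infinity, then for every [G] the counting function is at
    most [N / G] plus a constant, so the density is at most [1 / G]. *)
Lemma upper_density_gt0_liminf_gap (R : realType) (k : nat -> nat) :
  (0 < upper_density R k)%E -> (liminf_gap R k < +oo)%E.
Proof.
move=> d0; apply: contrapT => gap; move: d0; apply/negP; rewrite -leNgt.
have {}gap G : exists N, forall n, (N <= n)%N -> (k n + G <= k n.+1)%N.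
  apply: contrapT => /forallNP kG; apply: gap; apply/liminf_gap_ltyP; exists G => N.
  have /existsNP[n /not_implyP[Nn /negP kn]] := kG N.
  by exists n => //; rewrite ltnNge.
apply/lee_addgt0Pr => e e0; rewrite add0e.
(* [1 / G] uses up half of [e]; the other half absorbs the constant [n0.+1] for large [N]. *)
pose G := (Num.trunc (2 / e)).+1.
have Ge : G%:R^-1 <= e / 2.
  rewrite -[e / 2]invrK lef_pV2 ?posrE ?invr_gt0 ?divr_gt0// invf_div.
  by rewrite ltW// truncnS_gt.
have [n0 kG] := gap G.
rewrite /upper_density limn_esup_lim; apply: lime_le.
  exact: is_cvg_esups.
near=> N; apply: ge_ereal_sup => _ [n /= Nn <-]; rewrite lee_fin.
have n_gt0 : (0 < n)%N by apply: leq_trans Nn; near: N; exists 1%N.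
rewrite ler_pdivrMr ?ltr0n//.
apply: (@le_trans _ _ (n0.+1%:R + n%:R * (e / 2))).
  apply: (@le_trans _ _ (n0 + (n %/ G).+1)%:R).
    by rewrite ler_nat card_subsequence_le.
  rewrite -addSnnS natrD lerD2l (le_trans _ (ler_wpM2l (ler0n _ _) Ge))//.
  by rewrite ler_pdivlMr ?ltr0n// -natrM ler_nat leq_divM.
have : n0.+1%:R / (e / 2) <= n%:R.
  rewrite (@le_trans _ _ N%:R) ?ler_nat//; near: N; exact: nbhs_infty_ger.
rewrite ler_pdivrMr ?divr_gt0//; lra.
Unshelve. all: by end_near. Qed.

(** * Contractions on Hilbert spaces *)

Section DotProduct.
Variables (R : realType) (H : lmodType R[i]).
Variable ip : {dot H for (@Num.conj R[i])}.

Lemma dotC x y : ip x y = Num.conj (ip y x).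
Proof. by rewrite hermC expr0 mul1r. Qed.

Lemma dotZl a x y : ip (a *: x) y = a * ip x y.
Proof. exact: linearZl_LR. Qed.

Lemma dotZr a x y : ip x (a *: y) = Num.conj a * ip x y.
Proof. exact: linearZr_LR. Qed.

(** Pythagoras for the component of [y] orthogonal to [x]. Its nonnegativity gives the
    Cauchy-Schwarz inequality, its vanishing the equality case. *)
Lemma dot_sub_proj x y : x != 0 ->
  ip (y - (ip y x / ip x x) *: x) (y - (ip y x / ip x x) *: x) =
  ip y y - `|ip y x| ^+ 2 / ip x x.
Proof.
move=> x0; have nx0 : ip x x != 0 by rewrite dnorm_eq0.
have nxr : Num.conj (ip x x) = ip x x by rewrite -dotC.
rewrite linearBl !linearBr /= !dotZl !dotZr.
rewrite rmorphM fmorphV /= nxr (dotC x y) normCK.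
by field.
Qed.

Lemma dot_CauchySchwarz x y : `|ip y x| ^+ 2 <= ip y y * ip x x.
Proof.
have [->|x0] := eqVneq x 0; first by rewrite !raddf0 normr0 expr0n mulr0.
have := dnorm_ge0 ip (y - (ip y x / ip x x) *: x).
by rewrite dot_sub_proj// subr_ge0 ler_pdivrMr ?dnorm_gt0.
Qed.

(** The component of [y] orthogonal to [x] has squared length [ip y y - ip x x], which is at most
    0. *)
Lemma dot_CauchySchwarz_eq x y : x != 0 -> ip y y <= ip x x ->
  `|ip y x| = ip x x -> y = (ip y x / ip x x) *: x.
Proof.
move=> x0 yx e; apply/eqP; rewrite -subr_eq0 -(dnorm_eq0 ip).
rewrite eq_le dnorm_ge0 andbT dot_sub_proj// e expr2 mulfK ?dnorm_eq0//.
by rewrite subr_le0.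
Qed.

End DotProduct.

Lemma linear_continuous_bound (R : realType) (E : normedModType R[i])
    (f : {linear E -> R[i]^o}) : continuous f ->
  exists2 M : R, 0 < M & forall y, `|f y| <= M%:C * `|y|.
Proof.
move=> cf; have /linear_boundedP/pinfty_ex_gt0[M M0 fM] : bounded_near f (nbhs 0).
  exact/continuous_linear_bounded/cf.
have [M0' ME] := gt0_complexE M0.
by exists (complex.Re M) => // y; rewrite -ME.
Qed.

Lemma banach_hilbert_property (R : realType) (k : nat -> nat) :
  banach_property R k -> hilbert_property R k.
Proof.
move=> bk H ip ipE T T1 x x0 kx.
have nx0 : 0 < `|x| by rewrite normr_gt0.
apply: (bk H T _ x x0).
  apply/linear_boundedP; exists 1; split=> // r /ltW r1 y.
  by rewrite (le_trans (T1 y))// ler_peMl.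
move=> f cf; have [M M0 fM] := linear_continuous_bound cf.
pose c n := ip (iter (k n) T x) x / ip x x.
have Tk n : `|iter n T x| <= `|x|.
  by elim: n => //= n; apply: le_trans; exact: T1.
have c1 n : `|c n| = `|ip (iter (k n) T x) x| / `|x| ^+ 2.
  by rewrite normrM normfV -ipE normrX normr_id.
have cc : (fun n => `|c n| : R[i]^o) @ \oo --> (1 : R[i]^o).
  have nz : `|x| ^+ 2 != 0 by rewrite expf_neq0 ?gt_eqF.
  have -> : (fun n => `|c n| : R[i]^o) =
      (fun n => `|ip (iter (k n) T x) x| / `|x| ^+ 2) by apply/funext.
  exact: cvgC_divr nz kx.
(* The component of [T^(k n) x] orthogonal to [x] has squared norm [|T^(k n) x|^2 - |c n|^2 |x|^2],
   and contractivity bounds the first term by [|x|^2]. *)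
have res n : `|iter (k n) T x - c n *: x| ^+ 2 <= `|x| ^+ 2 * (1 - `|c n| ^+ 2).
  have := dot_sub_proj ip (iter (k n) T x) x0.
  rewrite -/(c n) (ipE (_ - _)) => ->; rewrite mulrBr mulr1 -!ipE c1 expr_div_n lerB//.
    by rewrite lerXn2r ?nnegrE.
  rewrite le_eqVlt; apply/orP; left; apply/eqP; field.
  by rewrite gt_eqF.
have [y0 yE] := gt0_complexE nx0; set X := complex.Re _ in y0 yE.
have [F F0 FE] : exists2 F : R, 0 < F & `|f x| <= F%:C.
  exists (M * X); first exact: mulr_gt0.
  by rewrite rmorphM /= -yE.
have cc2 : (fun n => `|c n| ^+ 2 : R[i]^o) @ \oo --> (1 : R[i]^o).
  by rewrite -[1](expr1n _ 2); exact: cvgC_sqr cc.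
apply/cvgCP => e e0.
have e2 : 0 < e / 2 / F by rewrite !divr_gt0.
have [N1 cN1] := (cvgCP _ _).1 cc _ e2.
(* [res] controls the square of the residual, so [|c n| ^+ 2] has to be within a squared tolerance
   of 1. *)
have e3 : 0 < (e / 2 / (M * X)) ^+ 2 by rewrite exprn_gt0// !divr_gt0// mulr_gt0.
have [N2 cN2] := (cvgCP _ _).1 cc2 _ e3.
exists (maxn N1 N2) => n; rewrite geq_max => /andP[/cN1 n1 /cN2 n2].
(* The difference is split at [|c n * f x|]: one part is bounded through the residual, the other
   through the defect [|c n| - 1]. *)
rewrite (@le_lt_trans _ _ (`|f (iter (k n) T x) - c n * f x| + `|(`|c n| - 1) * f x|))//.
  have -> : `|f (iter (k n) T x)| - `|f x| =
      (`|f (iter (k n) T x)| - `|c n * f x|) + (`|c n| - 1) * `|f x|.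
    by rewrite normrM; ring.
  rewrite (le_trans (ler_normD _ _))// lerD ?ler_dist_dist//.
  by rewrite !normrM normr_id.
rewrite [e]splitr rmorphD ltrD//=.
  have -> : f (iter (k n) T x) - c n * f x = f (iter (k n) T x - c n *: x).
    by rewrite linearB; congr (_ - _); exact: esym (linearZ_LR _ _ _).
  rewrite (le_lt_trans (fM _))//.
  rewrite -ltr_pdivlMl ?ltcR// -fmorphV -rmorphM/=.
  rewrite -(@ltr_pXn2r _ 2) ?nnegrE//; last by rewrite lecR mulr_ge0 ?invr_ge0 ?ltW// divr_gt0.
  rewrite (le_lt_trans (res n))// yE -rmorphXn -ltr_pdivlMl ?ltcR ?exprn_gt0//.
  have rc : 1 - `|c n| ^+ 2 \is Num.real.
    by rewrite rpredB ?rpred1// rpredX// normr_real.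
  rewrite (le_lt_trans (real_ler_norm rc))//.
  rewrite distrC (lt_le_trans n2)// -fmorphV -rmorphXn -rmorphM lecR /=.
  rewrite le_eqVlt; apply/orP; left; apply/eqP; field.
  by rewrite !gt_eqF.
rewrite normrM (le_lt_trans (ler_wpM2l _ FE))// -ltr_pdivlMr ?ltcR//.
by rewrite -fmorphV -rmorphM/=.
Unshelve. all: by end_near. Qed.

(** * Separation of points by continuous functionals *)

Section HahnBanach.
Variables (R : realType) (E : normedModType R[i]).

Let N (v : E) : R := complex.Re `|v|.

Let NE v : `|v| = (N v)%:C.
Proof.
by rewrite /N RRe_real// normr_real.
Qed.

Let N_triangle v w : N (v + w) <= N v + N w.
Proof. by rewrite -lecR rmorphD/= -!NE ler_normD. Qed.

Let N_scale (r : R) v : N (r%:C *: v) = `|r| * N v.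
Proof.
apply: complexI; rewrite rmorphM /= -!NE normrZ normc_def /= expr0n /= addr0.
by rewrite sqrtr_sqr.
Qed.

(* Partial real functionals are represented by their graphs; domination by the
   norm makes a linear graph single-valued. *)
Let dominated_graph (G : set (E * R)) :=
  (forall v a w b r, G (v, a) -> G (w, b) -> G (v + r%:C *: w, a + r * b)) /\
  (forall v a, G (v, a) -> a <= N v).

Let extend (G : set (E * R)) u c : set (E * R) :=
  [set p | exists v a r, [/\ G (v, a), p.1 = v + r%:C *: u & p.2 = a + r * c]].

(** One-dimensional step of the Hahn-Banach theorem: domination confines the value [c] at [u]
    between the numbers [a - N (v - u)] and the numbers [N (w + u) - b], and the supremum of the
    former fits. *)
Let dominated_extend G u : dominated_graph G -> G !=set0 ->
  exists c, dominated_graph (extend G u c).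
Proof.
move=> [Glin Gdom] [[v0 a0] G0].
have G00 : G (0, 0).
  by have := Glin _ _ _ _ (-1) G0 G0; rewrite rmorphN1 scaleN1r mulN1r !subrr.
have Gscale v a r : G (v, a) -> G (r%:C *: v, r * a).
  by move=> Gv; have := Glin _ _ _ _ r G00 Gv; rewrite !add0r.
pose L := [set x : R | exists v a, G (v, a) /\ x = a - N (v - u)].
have LU x w b : L x -> G (w, b) -> x <= N (w + u) - b.
  move=> [v [a [Ga ->]]] Gb; rewrite lerBrDr addrAC lerBlDr.
  have := Gdom _ _ (Glin _ _ _ _ 1 Ga Gb); rewrite mul1r scale1r => /le_trans; apply.
  rewrite addrC; apply: le_trans (N_triangle _ _).
  by rewrite addrACA addrN addr0 addrC.
have L0 : L !=set0 by exists (0 - N (0 - u)), 0, 0.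
have supL : has_sup L.
  by split=> //; exists (N (0 + u) - 0) => x Lx; exact: LU.
exists (sup L); split=> [v a w b r|v a].
  move=> [v1 [a1 [r1 [G1 /= -> ->]]]] [v2 [a2 [r2 [G2 /= -> ->]]]].
  exists (v1 + r%:C *: v2), (a1 + r * a2), (r1 + r * r2); split=> /=.
  - exact: Glin.
  - by rewrite scalerDr scalerA rmorphD rmorphM scalerDl addrACA.
  - ring.
move=> [w [b [r [Gb /= -> ->]]]].
(* Rescaling by [|r|^-1] reduces to the coefficients 1 and -1 of [u]: positive [r] calls for the
   upper bounds on [c], negative [r] for the lower ones. *)
have [r0|r0|->] := ltgtP r 0; last first.
- by rewrite mul0r scale0r !addr0 Gdom.
- have := @ge_sup _ L _ L0 (fun x Lx => LU x _ _ Lx (Gscale _ _ r^-1 Gb)).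
  rewrite -(ler_pM2l r0) mulrBr mulrA divff ?gt_eqF// mul1r lerBrDr addrC.
  move=> /le_trans; apply; rewrite -{1}(gtr0_norm r0) -N_scale scalerDr scalerA.
  by rewrite -rmorphM divff ?gt_eqF// scale1r.
- have r0' : 0 < - r by rewrite oppr_gt0.
  have : L ((- r^-1) * b - N ((- r^-1)%:C *: w - u)).
    by exists ((- r^-1)%:C *: w), (- r^-1 * b); split=> //; exact: Gscale.
  move=> /(sup_upper_bound supL); rewrite -(ler_pM2l r0') mulrBr mulrA mulrNN.
  rewrite divff ?lt_eqF// mul1r -{1}(gtr0_norm r0') -N_scale scalerBr scalerA.
  rewrite -rmorphM mulrNN divff ?lt_eqF// scale1r rmorphN scaleNr opprK mulNr.
  by rewrite lerBlDr addrC -lerBlDr opprK addrC => /le_trans; apply.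
Qed.


Lemma real_hahn_banach (y : E) : exists g : E -> R,
  [/\ forall v w (r : R), g (v + r%:C *: w) = g v + r * g w,
      forall v, g v <= complex.Re `|v| & g y = complex.Re `|y|].
Proof.
pose G0 : set (E * R) := [set p | exists r : R, p = (r%:C *: y, r * N y)].
have PG0 : dominated_graph G0.
  split=> [_ _ _ _ r [r1 [-> ->]] [r2 [-> ->]]|_ _ [r [-> ->]]].
    exists (r1 + r * r2); congr (_, _); last by rewrite mulrDl mulrA.
    by rewrite scalerA -scalerDl rmorphD rmorphM.
  rewrite N_scale ler_wpM2r ?ler_norm// -lecR -NE.
  exact: normr_ge0.
have G0y : G0 (y, N y) by exists 1; rewrite scale1r mul1r.
(* Uniting with [G0] makes the empty set admissible, which covers the empty chain in Zorn's
   lemma. *)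
pose Q (A : set (E * R)) := dominated_graph (A `|` G0).
have [F QF|G [PG Gmax]] := @Zorn_bigcup _ Q.
  move=> Ftot.
  have [[A0 FA0]|/set0P/negP/negPn/eqP F0] := pselect (F !=set0); last first.
    by rewrite /Q F0 bigcup_set0 set0U.
  have common p q : (\bigcup_(X in F) X `|` G0) p -> (\bigcup_(X in F) X `|` G0) q ->
      exists2 A, F A & (A `|` G0) p /\ (A `|` G0) q.
    move=> [[A FA Ap]|Gp] [[B FB Bq]|Gq].
    - have [AB|BA] := Ftot _ _ FA FB.
        by exists B => //; split; left=> //; exact: AB.
      by exists A => //; split; left=> //; exact: BA.
    - by exists A => //; split; [left|right].
    - by exists B => //; split; [right|left].
    - by exists A0 => //; split; right.
  split=> [v a w b r va wb|v a va].
    have [A FA [Av Aw]] := common _ _ va wb.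
    have [Alin _] := QF _ FA; have [AG|GG] := Alin _ _ _ _ r Av Aw; last by right.
    by left; exists A.
  have [A FA [Av _]] := common _ _ va va.
  by have [_] := QF _ FA; apply.
have [Hlin Hdom] := PG.
set H := G `|` G0 in PG Hlin Hdom.
have Hy : H (y, N y) by right.
(* By maximality the extension of [H] at [u] adds nothing new, so [u] already lies in the domain. *)
have tot u : exists c, H (u, c).
  have [c [Elin Edom]] := @dominated_extend H u PG (ex_intro _ _ Hy).
  exists c; apply: contrapT => nHu.
  have HE : H `<=` extend H u c.
    by move=> [v a] Hva; exists v, a, 0; split; rewrite //= ?scale0r ?mul0r addr0.
  have H00 : H (0, 0).
    by have := Hlin _ _ _ _ (-1) Hy Hy; rewrite rmorphN1 scaleN1r mulN1r !subrr.
  apply: (Gmax (extend H u c)).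
    split; first by move=> p Gp; apply: HE; left.
    by move=> /(_ (u, c)) h; apply: nHu; left; apply: h; exists 0, 0, 1;
      split; rewrite //= ?scale1r ?mul1r add0r.
  rewrite /Q; have -> : extend H u c `|` G0 = extend H u c by
    apply/setUidPl => p Gp; apply: HE; right.
  by [].
have [g Hg] := choice tot.
have uniqH v a b : H (v, a) -> H (v, b) -> a = b.
  move=> Ha Hb; have N0 : N 0 = 0 by rewrite /N normr0.
  apply/eqP; rewrite eq_le; apply/andP; split; rewrite -subr_le0 -N0.
    by have := Hdom _ _ (Hlin _ _ _ _ (-1) Ha Hb); rewrite rmorphN1 scaleN1r mulN1r subrr.
  by have := Hdom _ _ (Hlin _ _ _ _ (-1) Hb Ha); rewrite rmorphN1 scaleN1r mulN1r subrr.
exists g; split=> [v w r|v|]; last exact: (uniqH _ _ _ (Hg y)).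
  exact: (uniqH _ _ _ (Hg _)) (Hlin _ _ _ _ _ (Hg v) (Hg w)).
exact: Hdom (Hg v).
Qed.

(** The complexification [g v - i g (i v)] of a real linear [g] is complex linear; if [g] attains
    the norm at [y], the real part of its value there is the norm of [y]. *)
Lemma hahn_banach_separation (y : E) : y != 0 ->
  exists f : {linear E -> R[i]^o}, continuous f /\ f y != 0.
Proof.
move=> y0; have [g [glin gdom gy]] := real_hahn_banach y.
have gD v w : g (v + w) = g v + g w.
  by have := glin v w 1; rewrite scale1r mul1r.
have g0 : g 0 = 0 by have := gD 0 0; rewrite addr0 -[LHS]addr0 => /addrI.
have gZ (r : R) v : g (r%:C *: v) = r * g v.
  by have := glin 0 v r; rewrite g0 !add0r.
have gN v : g (- v) = - g v.
  by have := gZ (-1) v; rewrite rmorphN1 scaleN1r mulN1r.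
pose f (v : E) : R[i]^o := (g v) +i* (- g ('i *: v)).
have gC (a b : R) v : g ((a +i* b) *: v) = a * g v + b * g ('i *: v).
  have -> : a +i* b = a%:C + b%:C * 'i by rewrite [LHS]complexE mulrC.
  by rewrite scalerDl -scalerA gD !gZ.
have f_linear : linear f.
  move=> [a b] v w.
  have e1 : g ((a +i* b) *: v + w) = a * g v + b * g ('i *: v) + g w.
    by rewrite gD gC.
  have e2 : g ('i *: ((a +i* b) *: v + w)) =
      - b * g v + a * g ('i *: v) + g ('i *: w).
    rewrite scalerDr scalerA gD (_ : 'i * (a +i* b) = - b +i* a); last first.
      by apply/eqP; rewrite eq_complex /= !mul0r !mul1r sub0r add0r !eqxx.
    by rewrite gC.
  rewrite /f e1 e2; apply/eqP; rewrite eq_complex /=.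
  by apply/andP; split; apply/eqP; ring.
pose fL := GRing.isLinear.Build _ _ _ _ f f_linear.
pose F : {linear E -> R[i]^o} := HB.pack f fL.
exists F; split; last first.
  rewrite /F /= /f gy; apply: contra_neq y0 => -[Ny _].
  by apply/eqP; rewrite -normr_eq0 NE /N Ny.
apply: bounded_linear_continuous; apply/linear_boundedP.
(* The real and the imaginary part are each bounded by the norm of [v], whence the constant 2. *)
exists 2; split=> // r /ltW r2 v; rewrite (le_trans _ (ler_wpM2r _ r2))//.
have gle w : `|g w| <= N w.
  by rewrite ler_norml gdom andbT lerNl -gN (le_trans (gdom _))// normrN.
rewrite [F v]complexE (le_trans (ler_normD _ _))// normrM /=.
rewrite norm_i mul1r !normc_real normrN mulr_natl mulr2n.
rewrite lerD// NE lecR ?gle// (le_trans (gle _))// /N normrZ norm_i mul1r//.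
Qed.

End HahnBanach.

(** * Unimodular numbers and positive definite sequences *)

Section CircleParametrization.
Variable R : realType.

Definition expi (t : R) : R[i] := cos (2 * pi * t) +i* sin (2 * pi * t).

Lemma expiD s t : expi (s + t) = expi s * expi t.
Proof.
rewrite /expi mulrDr cosD sinD; apply/eqP; rewrite eq_complex /= eqxx /=.
by apply/eqP; ring.
Qed.

Lemma expi0 : expi 0 = 1.
Proof. by rewrite /expi mulr0 cos0 sin0. Qed.

Lemma expi1 : expi 1 = 1.
Proof. by rewrite /expi mulr1 mulr_natl cos2pi sin2pi. Qed.

Lemma expiX t n : expi t ^+ n = expi (n%:R * t).
Proof.
elim: n => [|n IH]; first by rewrite mul0r expi0.
by rewrite exprS IH -expiD mulrSr addrC mulrDl mul1r.
Qed.

Lemma norm_expi t : `|expi t| = 1.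
Proof. by rewrite normc_def /= cos2Dsin2 sqrtr1. Qed.

(** [cos (2 pi t) = 1 - 2 sin (pi t)^2], and the sine is positive for [pi t] strictly between 0 and
    [pi]. *)
Lemma expi_neq1 t : 0 < t < 1 -> expi t != 1.
Proof.
move=> /andP[t0 t1]; apply/eqP => -[c1 _].
have s0 : 0 < sin (pi * t).
  by apply: sin_gt0_pi; rewrite mulr_gt0 ?pi_gt0//= gtr_pMr ?pi_gt0.
have : cos (2 * pi * t) = 1 - 2 * sin (pi * t) ^+ 2.
  rewrite (_ : 2 * pi * t = (pi * t) *+ 2); last by ring.
  by rewrite cos_mulr2n cos2sin2; ring.
rewrite c1 => /eqP; rewrite eq_sym -subr_eq0 addrAC subrr sub0r oppr_eq0.
by rewrite mulf_eq0 pnatr_eq0/= expf_eq0/= gt_eqF.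
Qed.

Lemma sum_expi_root (z : R[i]) N : z ^+ N = 1 ->
  \sum_(j < N) z ^+ j = if z == 1 then N%:R else 0.
Proof.
move=> zN; have [->|z1] := eqVneq.
  by under eq_bigr do rewrite expr1n; rewrite sumr_const card_ord.
have := subrX1 z N; rewrite zN subrr => /esym/eqP.
by rewrite mulf_eq0 subr_eq0 (negPf z1) => /eqP.
Qed.

(** By periodicity [i] may be replaced by its remainder modulo [N], which puts the parameter into
    [[0, 1)]. *)
Lemma expi_div_eq1 N i : (0 < N)%N -> (expi (i%:R / N%:R) == 1) = (N %| i)%N.
Proof.
move=> N0; have N0' : 0 < N%:R :> R by rewrite ltr0n.
have -> : i%:R / N%:R = (i %/ N)%:R * 1 + (i %% N)%:R / N%:R :> R.
  by rewrite mulr1 {1}(divn_eq i N) natrD mulrDl natrM mulfK ?gt_eqF.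
rewrite expiD -expiX expi1 expr1n mul1r /dvdn.
have [->|r0] := posnP (i %% N)%N; first by rewrite mul0r expi0 eqxx.
by apply/negbTE/expi_neq1; rewrite divr_gt0 ?ltr0n//= ltr_pdivrMr// mul1r ltr_nat ltn_pmod.
Qed.

Lemma cos_lipschitz (s t : R) : `|cos s - cos t| <= `|s - t|.
Proof.
wlog st : s t / t <= s.
  by move=> h; have [/h//|/ltW/h] := leP t s; rewrite distrC [leRHS]distrC.
have [|c _ ->] := @MVT_segment R (@cos R) (fun x => - sin x) t s st.
  by apply: continuous_subspaceT => x; exact: continuous_cos.
by rewrite normrM normrN ler_piMl// ler_norml sin_geN1 sin_le1.
Qed.

Lemma sin_lipschitz (s t : R) : `|sin s - sin t| <= `|s - t|.
Proof.
rewrite -!cosBpihalf (le_trans (cos_lipschitz _ _))//.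
by rewrite opprB addrA subrK.
Qed.

Lemma continuous_expi : continuous (expi : R -> R[i]^o).
Proof.
move=> t; apply/cvgrPdist_lt => e /gt0_complexE[e0 ->].
have pi0 := pi_gt0 R.
have d0 : 0 < complex.Re e / 2 / (2 * pi) by rewrite !divr_gt0 ?mulr_gt0.
near=> s; have : `|t - s| < complex.Re e / 2 / (2 * pi).
  by near: s; exact: cvgr_dist_lt.
rewrite ltr_pdivlMr ?mulr_gt0// => ts.
have arg : `|2 * pi * t - 2 * pi * s| < complex.Re e / 2.
  by rewrite -mulrBr normrM gtr0_norm ?mulr_gt0// mulrC.
rewrite [_ - _]complexE (le_lt_trans (ler_normD _ _))// normrM norm_i mul1r.
rewrite !normc_real [complex.Re e]splitr rmorphD ltrD//= ltcR /=.
  exact: le_lt_trans (cos_lipschitz _ _) arg.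
exact: le_lt_trans (sin_lipschitz _ _) arg.
Unshelve. all: by end_near. Qed.

End CircleParametrization.

(** The entry [c_(m - l)] of the Toeplitz matrix of [c], where [c_(-n)] is the conjugate of
    [c_n]. *)
Definition hermitian_toeplitz (R : realType) (c : nat -> R[i]) (m l : nat) : R[i] :=
  if (l <= m)%N then c (m - l)%N else Num.conj (c (l - m)%N).

Definition positive_definite (R : realType) (c : nat -> R[i]) :=
  forall N (a : nat -> R[i]),
    0 <= \sum_(m < N) \sum_(l < N) a m * Num.conj (a l) * hermitian_toeplitz c m l.

(** * Measures on the circle *)

Section BorelCircle.
Variable R : realType.

Lemma continuous_circle_val : continuous (fun z : circle R => \val z : R[i]^o).
Proof. exact: initial_continuous. Qed.

Lemma complex_dist_Re (z w : R[i]) : `|complex.Re z - complex.Re w|%:C <= `|z - w|.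
Proof.
rewrite normc_def lecR -sqrtr_sqr ler_wsqrtr//.
by case: z w => [a b] [c d] /=; rewrite lerDl sqr_ge0.
Qed.

Lemma complex_dist_Im (z w : R[i]) : `|complex.Im z - complex.Im w|%:C <= `|z - w|.
Proof.
rewrite normc_def lecR -sqrtr_sqr ler_wsqrtr//.
by case: z w => [a b] [c d] /=; rewrite lerDr sqr_ge0.
Qed.

Lemma continuous_Re : continuous (fun z : R[i]^o => complex.Re z : R).
Proof.
move=> z; apply/(@cvgrPdist_lt _ _ _ (nbhs z)) => e e0.
have e0' : 0 < e%:C :> R[i] by rewrite ltcR.
have := nbhsx_ballx (z : R[i]^o) _ e0'; apply: filterS => w.
rewrite -ball_normE /ball_ /= => zw; rewrite -ltcR.
exact: le_lt_trans (complex_dist_Re _ _) zw.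
Qed.

Lemma continuous_Im : continuous (fun z : R[i]^o => complex.Im z : R).
Proof.
move=> z; apply/(@cvgrPdist_lt _ _ _ (nbhs z)) => e e0.
have e0' : 0 < e%:C :> R[i] by rewrite ltcR.
have := nbhsx_ballx (z : R[i]^o) _ e0'; apply: filterS => w.
rewrite -ball_normE /ball_ /= => zw; rewrite -ltcR.
exact: le_lt_trans (complex_dist_Im _ _) zw.
Qed.

Lemma measurable_circle (f : circle R -> R) : continuous f ->
  measurable_fun [set: borel_circle R] (f : borel_circle R -> R).
Proof.
move=> /continuousP cf; apply: (measurability _ (RGenOpens.measurableE R)).
move=> _ [_ [a [b ->] <-]]; rewrite setTI; apply: sub_sigma_algebra.
exact/cf/interval_open.
Qed.

Lemma measurable_Re_circle_val :
  measurable_fun [set: borel_circle R] (fun z => complex.Re (circle_val z)).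
Proof.
apply: measurable_circle => z; apply: continuous_comp; last exact: continuous_Re.
exact: continuous_circle_val.
Qed.

Lemma measurable_Im_circle_val :
  measurable_fun [set: borel_circle R] (fun z => complex.Im (circle_val z)).
Proof.
apply: measurable_circle => z; apply: continuous_comp; last exact: continuous_Im.
exact: continuous_circle_val.
Qed.

Lemma norm_circle_val (z : borel_circle R) : `|circle_val z| = 1.
Proof. by have := valP (z : circle R); rewrite inE. Qed.

Lemma measurable_circle_powers n :
  measurable_fun [set: borel_circle R] (fun z => complex.Re (circle_val z ^+ n)) /\
  measurable_fun [set: borel_circle R] (fun z => complex.Im (circle_val z ^+ n)).
Proof.
elim: n => [|n [IHr IHi]]; first by split; exact: measurable_cst.
split.
  rewrite (_ : (fun _ => _) = (fun z => complex.Re (circle_val z) * complex.Re (circle_val z ^+ n)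
      - complex.Im (circle_val z) * complex.Im (circle_val z ^+ n))).
    by apply: measurable_funB; apply: measurable_funM => //;
       [exact: measurable_Re_circle_val|exact: measurable_Im_circle_val].
  by apply/funext => z; rewrite exprS; case: (circle_val z) (_ ^+ n) => [a b] [].
rewrite (_ : (fun _ => _) = (fun z => complex.Re (circle_val z) * complex.Im (circle_val z ^+ n)
    + complex.Im (circle_val z) * complex.Re (circle_val z ^+ n))).
  by apply: measurable_funD; apply: measurable_funM => //;
     [exact: measurable_Re_circle_val|exact: measurable_Im_circle_val].
by apply/funext => z; rewrite exprS; case: (circle_val z) (_ ^+ n) => [a b] [].
Qed.

Lemma Rintegral_is_dirac (mu : probability (borel_circle R) R) (a : borel_circle R) f :
  (forall A : set (borel_circle R), measurable A -> mu A = \d_a A) ->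
  measurable_fun setT f -> \int[mu]_z f z = f a.
Proof.
move=> mua mf; rewrite /Rintegral (@eq_measure_integral _ _ _ _ \d_a).
  by rewrite integral_dirac ?diracT ?mul1e//; exact/measurable_EFinP.
by move=> A mA _; exact: mua.
Qed.

Lemma fourier_coef_dirac (mu : probability (borel_circle R) R) : is_dirac mu ->
  exists a : borel_circle R, forall n, fourier_coef mu n = circle_val a ^+ n.
Proof.
move=> [a mua]; exists a => n; have [mr mi] := measurable_circle_powers n.
rewrite /fourier_coef !(Rintegral_is_dirac mua)//.
by case: (circle_val a ^+ n).
Qed.

Definition to_circle (t : R) : borel_circle R :=
  SigSub (mem_set (norm_expi t) : expi t \in @unit_circle R).

Lemma measurable_to_circle (q : R -> R) : measurable_fun setT q ->
  measurable_fun setT (to_circle \o q).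
Proof.
move=> mq; apply: measurableT_comp => //.
apply: (@measurability _ _ _ (borel_circle R) _ _ open) => //.
move=> _ [A oA <-]; rewrite setTI; apply: open_measurable.
have ct : continuous (to_circle : R -> circle R).
  by apply: continuous_comp_initial; exact: continuous_expi.
by move/continuousP: ct; apply.
Qed.

Lemma bounded_integrable d (T : measurableType d) (P : probability T R) (f : T -> R) (M : R) :
  measurable_fun setT f -> (forall x, `|f x| <= M) -> P.-integrable setT (EFin \o f).
Proof.
move=> mf fM; apply: measurable_bounded_integrable => //.
  by rewrite (le_lt_trans (probability_le1 P measurableT))// ltry.
exists M; split=> [|N MN x _]; first exact: num_real.
by rewrite /= (le_trans (fM x))// ltW.
Qed.

End BorelCircle.

(** * Herglotz' theorem *)

Section StepIntegral.
Variable R : realType.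

Let U : measurableType _ := measurableTypeR R.
Let P : probability U R := uniform_prob (@ltr01 R).

Lemma uniform_prob_itv (a b : R) : 0 <= a -> a <= b -> b <= 1 ->
  P (`[a, b[%classic : set U) = (b - a)%:E.
Proof.
move=> a0 ab b1; rewrite /P /= /uniform_prob.
rewrite (eq_integral (fun=> 1%E)); last first.
  move=> x; rewrite inE /= in_itv /= => /andP[ax xb].
  rewrite /uniform_pdf (le_trans a0 ax)/= (le_trans (ltW xb) b1).
  by rewrite subr0 invr1.
rewrite integral_cst /=; last exact: measurable_itv.
rewrite mul1e lebesgue_measure_itv /= lte_fin.
have [//|ba] := ltP a b.
by rewrite (@le_anti _ _ a b) ?subrr ?ab.
Qed.

Lemma Rintegral_itv_approx (f : U -> R) (M a b c e : R) :
  measurable_fun setT f -> (forall x, `|f x| <= M) ->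
  0 <= a -> a <= b -> b <= 1 ->
  (forall x, a <= x < b -> `|f x - c| <= e) ->
  `|\int[P]_(x in (`[a, b[%classic : set U)) f x - c * (b - a)| <= e * (b - a).
Proof.
move=> mf fM a0 ab b1 fce; set D : set U := `[a, b[%classic.
have mD : measurable D by exact: measurable_itv.
have PD : fine (P D) = b - a by rewrite uniform_prob_itv.
have intf : P.-integrable D (EFin \o f).
  by apply: integrableS (bounded_integrable P mf fM).
have intc r : P.-integrable D (EFin \o (fun _ => r)).
  by apply: (@integrableS _ _ _ P setT) => //; apply: (@bounded_integrable _ _ _ _ _ `|r|).
rewrite -[b - a]PD -!Rintegral_cst// -RintegralB//.
have intfc : P.-integrable D (EFin \o (fun x => f x - c)).
  by have := integrableB mD intf (intc c).
apply: (le_trans (le_normr_Rintegral mD intfc)).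
by apply: le_Rintegral => //; apply: integrable_norm intfc.
Qed.

(** The error may vary with the interval. Zero errors yield exact integrals of step functions;
    errors proportional to the increments of a monotone function telescope. *)
Lemma Rintegral_partition_approx (f : U -> R) (M : R) (t c e : nat -> R) n :
  measurable_fun setT f -> (forall x, `|f x| <= M) ->
  t 0%N = 0 -> t n = 1 -> (forall i, (i < n)%N -> t i <= t i.+1) ->
  (forall i x, (i < n)%N -> t i <= x < t i.+1 -> `|f x - c i| <= e i) ->
  `|\int[P]_x f x - \sum_(i < n) c i * (t i.+1 - t i)| <=
  \sum_(i < n) e i * (t i.+1 - t i).
Proof.
move=> mf fM t0 tn tmono fce.
have intf (D : set U) : measurable D -> P.-integrable D (EFin \o f).
  by move=> mD; apply: integrableS (bounded_integrable P mf fM).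
have tle i j : (i <= j)%N -> (j <= n)%N -> t i <= t j.
  elim: j => [|j IH]; first by rewrite leqn0 => /eqP ->.
  rewrite leq_eqVlt ltnS => /predU1P[->//|ij] jn.
  by rewrite (le_trans (IH ij (ltnW jn)))// tmono.
have step j : (j <= n)%N ->
    `|\int[P]_(x in (`[t 0%N, t j[%classic : set U)) f x - \sum_(i < j) c i * (t i.+1 - t i)| <=
    \sum_(i < j) e i * (t i.+1 - t i).
  elim: j => [_|j IH jn].
    by rewrite !big_ord0 set_itv_ge ?bnd_simp ?ltxx// Rintegral_set0 subrr normr0.
  rewrite !big_ord_recr /= (@set_interval.itv_bndbnd_setU _ _ _ (BLeft (t j))); last 2 first.
  - by rewrite bnd_simp tle// ltnW.
  - by rewrite bnd_simp tmono.
  rewrite Rintegral_setU//=.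
  - rewrite opprD addrACA (le_trans (ler_normD _ _))// lerD ?IH 1?ltnW//.
    apply: Rintegral_itv_approx mf fM _ (tmono _ jn) _ _.
    + by rewrite -t0 tle// ltnW.
    + by rewrite -tn tle.
    + by move=> x; apply: fce.
  - exact/intf/measurableU.
  - apply/disj_set2P/seteqP; split=> // x [/=]; rewrite !in_itv /= => /andP[_ xj] /andP[jx _].
    by move: xj; rewrite ltNge jx.
(* The half-open intervals of the partition cover [[0, 1)], which has full measure. *)
have P1 : P (~` (`[0, 1[%classic : set U)) = 0%E.
  rewrite probability_setC// uniform_prob_itv// subr0.
  by rewrite -EFinB subrr.
have : \int[P]_x f x = \int[P]_(x in (`[t 0%N, t n[%classic : set U)) f x.
  rewrite t0 tn /Rintegral (@negligible_integral _ _ _ P setT (~` (`[0, 1[%classic : set U)))//.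
  - by rewrite setTD setCK.
  - exact: measurableC.
  - exact: intf.
by move=> ->; exact: step.
Qed.

(** On each of the [M] intervals the integrand varies by at most [K] times the increment of [q].
    These increments sum to at most 1, so the error is uniform over all monotone [q] with values in
    [[0, 1]]. *)
Lemma Rintegral_monotone_riemann (g q : U -> R) (K B : R) M : (0 < M)%N ->
  measurable_fun setT g -> (forall x, `|g x| <= B) -> 0 <= K ->
  (forall x y, `|g x - g y| <= K * `|x - y|) ->
  {homo q : x y / x <= y} -> (forall x, 0 <= q x <= 1) ->
  `|\int[P]_x g (q x) - \sum_(i < M) g (q (i%:R / M%:R)) / M%:R| <= K / M%:R.
Proof.
move=> M0 mg gB K0 gK qmono q01; have M0' : 0 < M%:R :> R by rewrite ltr0n.
have mq : measurable_fun setT q by exact: nondecreasing_measurable.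
pose t i : R := i%:R / M%:R; pose e i := K * (q (t i.+1) - q (t i)).
have tS i : t i.+1 - t i = M%:R^-1 by rewrite -mulrBl -natrB// subSnn mul1r.
have := @Rintegral_partition_approx (g \o q) B t (g \o q \o t) e M.
rewrite /= => h; apply: (le_trans (y := \sum_(i < M) e i * (t i.+1 - t i))); last first.
  under eq_bigr do rewrite tS.
  rewrite -mulr_suml ler_pM2r ?invr_gt0// -mulr_sumr -[leRHS]mulr1 ler_wpM2l//.
  rewrite -(big_mkord xpredT (fun i => q (t i.+1) - q (t i))) telescope_sumr//.
  have /andP[_ h1] := q01 (t M); have /andP[h0 _] := q01 (t 0%N).
  by rewrite lerBlDr ler_wpDr.
have -> : \sum_(i < M) g (q (i%:R / M%:R)) / M%:R =
    \sum_(i < M) g (q (t i)) * (t i.+1 - t i).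
  by apply: eq_bigr => i _; rewrite tS.
apply: h => //.
- exact: measurableT_comp.
- by rewrite /t mul0r.
- by rewrite /t divff ?gt_eqF.
- by move=> i _; rewrite -subr_ge0 tS invr_ge0 ltW.
- move=> i x _ /andP[tx xt]; rewrite (le_trans (gK _ _))// ler_wpM2l//.
  by rewrite ger0_norm ?subr_ge0 ?qmono// lerD2r qmono// ltW.
Qed.

End StepIntegral.

(** * Discrete measures on the roots of unity *)

Section DiscreteHerglotz.
Variables (R : realType) (c : nat -> R[i]).
Hypotheses (c_pd : positive_definite c) (c0 : c 0%N = 1).

(** The mass at the root of unity [expi (j / N)]: the Fejer mean at this point of the Fourier series
    with coefficients [c], divided by [N]. Written as a Toeplitz form, it is nonnegative by positive
    definiteness. *)
Definition herglotz_weight N j : R[i] := N%:R ^- 2 *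
  \sum_(m < N) \sum_(l < N) Num.conj (expi (j%:R / N%:R)) ^+ m *
    Num.conj (Num.conj (expi (j%:R / N%:R)) ^+ l) * hermitian_toeplitz c m l.

Lemma herglotz_weight_ge0 N j : 0 <= herglotz_weight N j.
Proof. by rewrite mulr_ge0 ?invr_ge0 ?exprn_ge0 ?ler0n//; exact: c_pd. Qed.

(** Summing over the roots of unity leaves only the pairs with [m = l + n] modulo [N]. For [N - n]
    values of [l] there is no wrap-around and the entry is [c n]; for the other [n] values
    [m - l = n - N], whence the conjugate of [c (N - n)]. *)
Lemma herglotz_moment N n : (n < N)%N ->
  \sum_(j < N) herglotz_weight N j * expi (j%:R / N%:R) ^+ n =
  ((N - n)%:R * c n + n%:R * Num.conj (c (N - n)%N)) / N%:R.
Proof.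
move=> nN; have N0 : (0 < N)%N by apply: leq_trans nN.
have N0' : N%:R != 0 :> R[i] by rewrite pnatr_eq0 -lt0n.
set z := expi (N%:R^-1 : R).
have zE j : expi (j%:R / N%:R : R) = z ^+ j by rewrite expiX.
have zN : z ^+ N = 1.
  by rewrite expiX divff ?expi1// pnatr_eq0 -lt0n.
have z0 : z != 0 by rewrite -normr_gt0 norm_expi.
(* Conjugates are turned into powers with natural exponents, so that all factors merge into a single
   power of [z]. *)
have zC (m : 'I_N) : Num.conj z ^+ m = z ^+ (N - m).
  apply: (mulIf (expf_neq0 m z0)); rewrite -exprD subnK ?zN ?(ltnW (ltn_ord _))//.
  by rewrite -exprMn mulrC -normCK norm_expi !expr1n.
transitivity (N%:R ^- 2 * \sum_(l < N) \sum_(m < N)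
    hermitian_toeplitz c m l * \sum_(j < N) (z ^+ (l + n + (N - m))%N) ^+ j).
  under eq_bigr do rewrite /herglotz_weight -mulrA mulr_suml.
  rewrite -mulr_sumr; congr (_ * _).
  rewrite [RHS]exchange_big /= exchange_big /=; apply: eq_bigr => m _.
  under eq_bigr do rewrite mulr_suml.
  rewrite exchange_big /=; apply: eq_bigr => l _.
  rewrite mulr_sumr; apply: eq_bigr => j _.
  have -> : Num.conj (expi (j%:R / N%:R)) ^+ m = (z ^+ (N - m)) ^+ j.
    by rewrite zE rmorphXn /= exprAC zC.
  have -> : Num.conj (Num.conj (expi (j%:R / N%:R)) ^+ l) = (z ^+ l) ^+ j.
    by rewrite rmorphXn /= conjCK zE exprAC.
  by rewrite zE [_ ^+ j ^+ n]exprAC !exprD !exprMn; ring.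
have inner (l m : 'I_N) : \sum_(j < N) (z ^+ (l + n + (N - m))%N) ^+ j =
    if m == ((l + n) %% N)%N :> nat then N%:R else 0.
  rewrite sum_expi_root; last by rewrite exprAC zN expr1n.
  rewrite expiX expi_div_eq1//; congr (if _ then _ else _).
  have -> : (N %| l + n + (N - m))%N = (l + n + (N - m) == m + (N - m) %[mod N])%N.
    by rewrite (subnKC (ltnW (ltn_ord m))) modnn.
  by rewrite eqn_modDr (modn_small (ltn_ord m)) eq_sym.
transitivity (N%:R ^- 2 * \sum_(l < N)
    (if (l + n < N)%N then c n else Num.conj (c (N - n)%N)) * N%:R).
  congr (_ * _); apply: eq_bigr => l _.
  rewrite (bigD1 (Ordinal (ltn_pmod (l + n) N0)))//= [X in _ + X]big1 ?addr0; last first.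
    move=> m /eqP ml; rewrite inner ifF ?mulr0//; apply/negbTE/eqP => mE.
    by apply: ml; apply: val_inj.
  have /= -> := inner l (Ordinal (ltn_pmod (l + n) N0)); rewrite eqxx.
  congr (_ * _); rewrite /hermitian_toeplitz.
  have lN := ltn_ord l; case: ltnP => lnN.
    by rewrite modn_small// leq_addr addKn.
  have -> : ((l + n) %% N = l + n - N)%N.
    by rewrite -{1}(subnK lnN) modnDr modn_small//; lia.
  rewrite ifF; last by apply/negbTE; lia.
  by congr (Num.conj (c _)); lia.
rewrite -mulr_suml mulrA mulrAC expr2 invfM mulfVK// mulrC; congr (_ / _).
rewrite -(big_mkord xpredT
  (fun l => if (l + n < N)%N then c n else Num.conj (c (N - n)%N))).
rewrite (@big_cat_nat _ _ _ (N - n)) ?leq_subr//=.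
rewrite (@eq_big_nat _ _ _ 0 (N - n) _ (fun _ => c n)); last first.
  by move=> l /andP[_ lN]; rewrite ifT//; lia.
rewrite (@eq_big_nat _ _ _ (N - n) N _ (fun _ => Num.conj (c (N - n)%N))); last first.
  by move=> l /andP[lN _]; rewrite ifF//; apply/negbTE; lia.
by rewrite !sumr_const_nat subn0 subKn ?(ltnW nN)// !mulr_natl.
Qed.

Definition herglotz_mass N j : R := complex.Re (herglotz_weight N j).

Lemma herglotz_massE N j : herglotz_weight N j = (herglotz_mass N j)%:C.
Proof. by rewrite /herglotz_mass RRe_real// ger0_real// herglotz_weight_ge0. Qed.

Lemma herglotz_mass_ge0 N j : 0 <= herglotz_mass N j.
Proof. by rewrite -lecR -herglotz_massE herglotz_weight_ge0. Qed.

Definition herglotz_cdf N i : R := \sum_(j < i) herglotz_mass N j.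

Lemma herglotz_cdfS N i : herglotz_cdf N i.+1 - herglotz_cdf N i = herglotz_mass N i.
Proof. by rewrite /herglotz_cdf big_ord_recr /= addrAC subrr add0r. Qed.

Lemma herglotz_cdf_le N i j : (i <= j)%N -> herglotz_cdf N i <= herglotz_cdf N j.
Proof.
elim: j => [|j IH]; first by rewrite leqn0 => /eqP ->.
rewrite leq_eqVlt ltnS => /predU1P[->//|/IH/le_trans]; apply.
by rewrite -subr_ge0 herglotz_cdfS herglotz_mass_ge0.
Qed.

Lemma herglotz_cdf_total N : (0 < N)%N -> herglotz_cdf N N = 1.
Proof.
move=> N0; apply: complexI; rewrite rmorph_sum /= rmorph1.
have := herglotz_moment N0; rewrite subn0 c0 mulr1 mul0r addr0.
rewrite divff ?pnatr_eq0 -?lt0n// => <-.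
by apply: eq_bigr => j _; rewrite expr0 mulr1 herglotz_massE.
Qed.

(** The quantile function of the discrete measure, written as a sum of steps of height [1 / N]: this
    form is monotone with values in [[0, 1]] for every real [t]. *)
Definition herglotz_quantile N (t : R) : R :=
  \sum_(j < N) if herglotz_cdf N j.+1 <= t then N%:R^-1 else 0.

Lemma herglotz_quantile_mono N : {homo herglotz_quantile N : s t / s <= t}.
Proof.
move=> s t st; apply: ler_sum => j _.
case: ifPn => [h|_]; first by rewrite (le_trans h).
by case: ifPn; rewrite ?invr_ge0.
Qed.

Lemma herglotz_quantile01 N t : 0 <= herglotz_quantile N t <= 1.
Proof.
apply/andP; split.
  by apply: sumr_ge0 => j _; case: ifPn; rewrite ?invr_ge0.
case: N => [|N]; first by rewrite /herglotz_quantile big_ord0.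
apply: (@le_trans _ _ (\sum_(j < N.+1) N.+1%:R^-1)).
  by apply: ler_sum => j _; case: ifPn; rewrite ?invr_ge0.
by rewrite sumr_const card_ord -[leLHS]mulr_natl divff.
Qed.

Lemma herglotz_quantileE N i t : (i < N)%N ->
  herglotz_cdf N i <= t < herglotz_cdf N i.+1 ->
  herglotz_quantile N t = i%:R / N%:R.
Proof.
move=> iN /andP[it ti]; rewrite /herglotz_quantile.
rewrite -(big_mkord xpredT (fun j => if herglotz_cdf N j.+1 <= t then N%:R^-1 else 0)).
rewrite (@big_cat_nat _ _ _ i) ?(ltnW iN)//=.
rewrite (@eq_big_nat _ _ _ 0 i _ (fun _ => N%:R^-1)); last first.
  by move=> j /andP[_ ji]; rewrite ifT// (le_trans _ it)// herglotz_cdf_le.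
rewrite (@eq_big_nat _ _ _ i N _ (fun _ => 0)); last first.
  move=> j /andP[ij _]; rewrite ifF//; apply/negbTE; rewrite -ltNge.
  by rewrite (lt_le_trans ti)// herglotz_cdf_le.
by rewrite sumr_const_nat big1 // addr0 subn0 mulr_natl.
Qed.

Let P : probability (measurableTypeR R) R := uniform_prob (@ltr01 R).

(** Between consecutive values of the cumulated mass the quantile function is constant, so the
    partition estimate holds with error 0. *)
Lemma Rintegral_herglotz_quantile N (g : R -> R) B : (0 < N)%N ->
  measurable_fun setT g -> (forall x, `|g x| <= B) ->
  \int[P]_t g (herglotz_quantile N t) =
  \sum_(j < N) g (j%:R / N%:R) * herglotz_mass N j.
Proof.
move=> N0 mg gB.
have mq : measurable_fun setT (herglotz_quantile N).
  by apply: nondecreasing_measurable => // s t; exact: herglotz_quantile_mono.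
have := @Rintegral_partition_approx _ (g \o herglotz_quantile N) B
  (herglotz_cdf N) (fun j => g (j%:R / N%:R)) (fun _ => 0) N.
move=> h; apply/eqP; rewrite -subr_eq0 -normr_le0.
have {h} := h (measurableT_comp mg mq) (fun x => gB _) (big_ord0 _ _ _ _)
  (herglotz_cdf_total N0).
under [X in _ <= X]eq_bigr do rewrite mul0r.
rewrite [X in _ <= X]big1//.
under eq_bigr do rewrite herglotz_cdfS.
apply=> [i _|i x iN /herglotz_quantileE]; first exact: herglotz_cdf_le.
by move=> /(_ iN) /= ->; rewrite subrr normr0.
Qed.

End DiscreteHerglotz.

(** * Limits of the discrete measures and Herglotz' theorem *)

Section HerglotzLimit.
Variable R : realType.

Let U := measurableTypeR R.
Let P : probability U R := uniform_prob (@ltr01 R).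

(* A pointwise limit along an ultrafilter stands in for Helly's selection
   theorem: Riemann sums approximate the integrals of Lipschitz functions
   uniformly over all monotone maps, so pointwise convergence suffices. *)
Lemma monotone_limit (q : nat -> R -> R) :
  (forall N, {homo q N : s t / s <= t}) -> (forall N t, 0 <= q N t <= 1) ->
  exists q' : R -> R, [/\ {homo q' : s t / s <= t}, forall t, 0 <= q' t <= 1 &
    forall (g : U -> R) (K B l : R), measurable_fun setT g ->
      (forall x, `|g x| <= B) -> 0 <= K ->
      (forall x y, `|g x - g y| <= K * `|x - y|) ->
      (fun N => \int[P]_t g (q N t)) @ \oo --> l ->
      \int[P]_t g (q' t) = l].
Proof.
move=> q_mono q01.
have [F [FU oF]] := ultraFilterLemma (@eventually_filter).
(* Compactness of the segment yields a cluster point, and along an ultrafilter a cluster point is a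
   limit. *)
have lim t : exists y : R, 0 <= y <= 1 /\ (fun N => q N t) @ F --> y.
  have [|y [/= y01 qy]] := @segment_compact R 0 1 ((q ^~ t) @ F) _.
    by apply: oF; exists 0%N => // N _ /=; rewrite in_itv /= q01.
  exists y; split=> [|V yV]; first by move: y01; rewrite in_itv.
  have [//|nV] := in_ultra_setVsetC ((q ^~ t) @^-1` V) FU.
  by have [z []] := qy (~` V) V nV yV.
have [q' q'P] := choice lim.
have q'_mono : {homo q' : s t / s <= t}.
  move=> s t st; apply: (ler_cvg_to (q'P s).2 (q'P t).2).
  by near=> N; exact: q_mono.
exists q'; split=> // [t|g K B l mg gB K0 gK gl]; first by have [] := q'P t.
apply/eqP; rewrite -subr_eq0 -normr_le0; apply/ler_addgt0Pr => e e0; rewrite add0r.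
pose d := e / 4; have d0 : 0 < d by rewrite divr_gt0.
pose M := (Num.trunc (K / d)).+1.
have KM : K / M%:R <= d.
  by rewrite ler_pdivrMr ?ltr0n// mulrC -ler_pdivrMr// ltW// truncnS_gt.
have K1 : 0 < K + 1 by rewrite ltr_wpDl.
(* Only the [M] nodes of the Riemann sum matter, so one [N] serves them all; dividing by [K + 1]
   keeps the tolerance meaningful when [K] is 0. *)
have close : \forall N \near F, forall i : 'I_M,
    `|q' (i%:R / M%:R) - q N (i%:R / M%:R)| < d / (K + 1).
  apply: filter_forall => i.
  have /cvgrPdist_lt := (q'P (i%:R / M%:R)).2.
  by apply; rewrite divr_gt0.
have near_l : \forall N \near F, `|l - \int[P]_t g (q N t)| < d.
  by apply: oF; move/cvgrPdist_lt: gl; exact.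
have [N [qN lN]] := @filter_ex _ F _ _ (filterI close near_l).
pose S (h : R -> R) : R := \sum_(i < M) g (h (i%:R / M%:R)) / M%:R.
have r1 := Rintegral_monotone_riemann (ltn0Sn _ : (0 < M)%N) mg gB K0 gK q'_mono
  (fun t => (q'P t).1).
have r2 := Rintegral_monotone_riemann (ltn0Sn _ : (0 < M)%N) mg gB K0 gK (q_mono N) (q01 N).
have r3 : `|S q' - S (q N)| <= d.
  rewrite /S -sumrB (le_trans (ler_norm_sum _ _ _))//.
  apply: (@le_trans _ _ (\sum_(i < M) d / M%:R)).
    apply: ler_sum => i _; rewrite -mulrBl normrM [X in _ * X]ger0_norm ?invr_ge0//.
    rewrite ler_pM2r ?invr_gt0 ?ltr0n// (le_trans (gK _ _))//.
    rewrite (le_trans (ler_wpM2l K0 (ltW (qN i))))//.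
    by rewrite mulrCA ler_piMr ?ltW// ltr_pdivrMr// mul1r ltrDl.
  by rewrite sumr_const card_ord -[leLHS]mulr_natr divfK ?pnatr_eq0.
rewrite -/(S q') -/(S (q N)) in r1 r2.
rewrite distrC in lN.
(* The path from one integral to the limit leads through the two Riemann sums; each of its four
   pieces is at most [d = e / 4]. *)
have -> : \int[P]_t g (q' t) - l = (\int[P]_t g (q' t) - S q') + (S q' - S (q N))
  + (S (q N) - \int[P]_t g (q N t)) + (\int[P]_t g (q N t) - l) by ring.
rewrite (le_trans (ler_normD _ _))// (le_trans (lerD (ler_normD _ _) (lexx _)))//.
rewrite (le_trans (lerD (lerD (ler_normD _ _) (lexx _)) (lexx _)))//.
rewrite distrC in r2.
have -> : e = d + d + d + d by rewrite /d; field.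
by rewrite !lerD// ?(le_trans r1)// ?(le_trans r2)// ltW.
Unshelve. all: by end_near. Qed.

Lemma herglotz (c : nat -> R[i]) : positive_definite c -> c 0%N = 1 ->
  (forall n, `|c n| <= 1) ->
  exists mu : probability (borel_circle R) R, forall n, fourier_coef mu n = c n.
Proof.
move=> c_pd c0 c1.
have [q [q_mono q01 qlim]] := monotone_limit
  (@herglotz_quantile_mono R c) (@herglotz_quantile01 R c).
have mq : measurable_fun setT (q : U -> R) by exact: nondecreasing_measurable.
have mX : measurable_fun (setT : set U) (to_circle (R := R) \o q : U -> borel_circle R).
  exact: measurable_to_circle mq.
pose X : {mfun U >-> borel_circle R} :=
  HB.pack (to_circle (R := R) \o q : U -> borel_circle R)
    (isMeasurableFun.Build _ _ _ _ _ mX).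
exists (distribution P X) => n.
have [mr mi] := measurable_circle_powers R n.
have pushf (f : borel_circle R -> R) : measurable_fun setT f ->
    (forall z, `|f z| <= 1) ->
    \int[distribution P X]_z f z = \int[P]_t f (to_circle (q t)).
  move=> mf f1; rewrite /Rintegral /distribution integral_pushforward//.
    exact/measurable_EFinP.
  apply: (@bounded_integrable _ _ _ P _ 1) => //; exact: measurableT_comp.
have circle1 (z : borel_circle R) : `|circle_val z ^+ n| = 1.
  by rewrite normrX norm_circle_val expr1n.
have Re1 (z : R[i]) : `|complex.Re z|%:C <= `|z|.
  by have := complex_dist_Re z 0; rewrite !subr0.
have Im1 (z : R[i]) : `|complex.Im z|%:C <= `|z|.
  by have := complex_dist_Im z 0; rewrite !subr0.
rewrite /fourier_coef !pushf//; last 2 first.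
- by move=> z; rewrite -lecR (le_trans (Im1 _)) ?circle1.
- by move=> z; rewrite -lecR (le_trans (Re1 _)) ?circle1.
have valE (t : R) : circle_val (to_circle t) ^+ n = expi (n%:R * t) by rewrite -expiX.
(* The [n]-th moment of the discrete measure on the [N]-th roots of unity; it differs from [c n] by
   [n / N] times a number of modulus at most 2. *)
pose m N := ((N - n)%:R * c n + n%:R * Num.conj (c (N - n)%N)) / N%:R : R[i].
have mc N : (n < N)%N -> `|m N - c n| <= (2 * n%:R / N%:R)%:C.
  move=> nN; have N0 : N%:R != 0 :> R[i] by rewrite pnatr_eq0 -lt0n (leq_trans _ nN).
  have -> : m N - c n = n%:R * (Num.conj (c (N - n)%N) - c n) / N%:R.
    by rewrite /m natrB ?(ltnW nN)//; field.
  rewrite normrM normfV !normrM !normr_nat [2 * _]mulrC !rmorphM /= fmorphV !rmorph_nat.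
  rewrite ler_wpM2r ?invr_ge0// ler_wpM2l// (le_trans (ler_normB _ _))//.
  by rewrite norm_conjC -[2]/(1 + 1) lerD.
have small (e : R) : 0 < e -> exists N0, forall N, (N0 <= N)%N ->
    (n < N)%N /\ 2 * n%:R / N%:R < e.
  move=> e0; exists (n + (Num.trunc (2 * n%:R / e)).+1)%N => N hN.
  have nN : (n < N)%N by lia.
  split=> //; rewrite ltr_pdivrMr ?ltr0n; last by lia.
  rewrite -ltr_pdivrMl// [e^-1 * _]mulrC (lt_le_trans (truncnS_gt _))// ler_nat.
  by rewrite (leq_trans _ hN)// leq_addl.
(* Real and imaginary parts are treated together: [f] stands for either of them, and [g] for the
   corresponding cosine or sine. *)
have tri (g : U -> R) (f : R[i] -> R) :
    (forall t, g t = f (expi (n%:R * t))) ->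
    (forall z w, `|f z - f w|%:C <= `|z - w|) ->
    (forall (r : R) z, f (r%:C * z) = r * f z) -> (forall z w, f (z + w) = f z + f w) ->
    (forall x, `|g x| <= 1) ->
    (forall x y, `|g x - g y| <= (2 * pi * n%:R) * `|x - y|) ->
    continuous (g : R -> R) ->
    \int[P]_t g (q t) = f (c n).
  move=> gE f1 fZ fD g1 gLip gcont.
  have mg : measurable_fun setT g by exact: continuous_measurable_fun.
  apply: (qlim g (2 * pi * n%:R) 1) => //.
    by rewrite !mulr_ge0// pi_ge0.
  apply/cvgrPdist_lt => e e0; have [N0 hN] := small _ e0.
  exists N0 => // N /= /hN[nN Ne].
  have N0' : (0 < N)%N by lia.
  rewrite (Rintegral_herglotz_quantile c_pd c0 N0' mg g1).
  have -> : \sum_(j < N) g (j%:R / N%:R) * herglotz_mass c N j = f (m N).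
    rewrite /m -(herglotz_moment c nN).
    elim/big_ind2 : _ => [|x1 x2 y1 y2 -> ->//|j _].
      by have := fZ 0 0; rewrite !mul0r.
    by rewrite (herglotz_massE c_pd) fZ gE expiX mulrC.
  rewrite -ltcR distrC (le_lt_trans (f1 _ _))// (le_lt_trans (mc _ nN))//.
  by rewrite ltcR.
rewrite [RHS](_ : _ = complex.Re (c n) +i* complex.Im (c n)); last by case: (c n).
have arg_lip s t : `|2 * pi * (n%:R * s) - 2 * pi * (n%:R * t)| = 2 * pi * n%:R * `|s - t|.
  by rewrite !mulrA -mulrBr normrM ger0_norm// !mulr_ge0// pi_ge0.
have arg_cont : continuous (fun t : R => 2 * pi * (n%:R * t)).
  by move=> t; apply: cvgM; [exact: cvg_cst|apply: cvgM; [exact: cvg_cst|exact: cvg_id]].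
congr (_ +i* _).
  under eq_Rintegral do rewrite valE /expi /=.
  apply: (tri (fun t => cos (2 * pi * (n%:R * t))) (@complex.Re R)) => //.
  - exact: complex_dist_Re.
  - by move=> r [a b]; rewrite /= mul0r subr0.
  - by move=> [a b] [? ?].
  - by move=> x; exact: cos_max.
  - by move=> x y; rewrite -arg_lip cos_lipschitz.
  - by move=> t; apply: continuous_comp; [exact: arg_cont|exact: continuous_cos].
under eq_Rintegral do rewrite valE /expi /=.
apply: (tri (fun t => sin (2 * pi * (n%:R * t))) (@complex.Im R)) => //.
- exact: complex_dist_Im.
- by move=> r [a b]; rewrite /= mul0r addr0.
- by move=> [a b] [? ?].
- by move=> x; exact: sin_max.
- by move=> x y; rewrite -arg_lip sin_lipschitz.
- by move=> t; apply: continuous_comp; [exact: arg_cont|exact: continuous_sin].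
Qed.

(** Extremality restated without measures: Herglotz' theorem supplies the measure, and the
    coefficients of a Dirac measure are the powers of its location. *)
Lemma extremal_positive_definite (k : nat -> nat) (c : nat -> R[i]) :
  extremal R k -> positive_definite c -> c 0%N = 1 -> (forall n, `|c n| <= 1) ->
  (fun n => `|c (k n)| : R[i]^o) @ \oo --> (1 : R[i]^o) ->
  exists2 a : R[i], `|a| = 1 & forall n, c n = a ^+ n.
Proof.
move=> ext c_pd c0 c1 ck; have [mu muc] := herglotz c_pd c0 c1.
have [|a mua] := @fourier_coef_dirac R mu.
  by apply: ext; under eq_fun do rewrite muc.
by exists (circle_val a) => [|n]; [exact: norm_circle_val|rewrite -mua muc].
Qed.

End HerglotzLimit.

(** * Coefficients of contractions *)

Lemma sum_square_recl (V : nmodType) (F : nat -> nat -> V) N :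
  \sum_(m < N.+1) \sum_(l < N.+1) F m l =
  F 0%N 0%N + \sum_(l < N) F 0%N l.+1 +
    (\sum_(m < N) F m.+1 0%N + \sum_(m < N) \sum_(l < N) F m.+1 l.+1).
Proof.
rewrite big_ord_recl big_ord_recl /= -big_split /=; congr (_ + _).
by apply: eq_bigr => m _; rewrite big_ord_recl.
Qed.

Section ContractionCoefficients.
Variables (R : realType) (H : completeNormedModType R[i]).
Variable ip : {dot H for (@Num.conj R[i])}.
Hypothesis ipE : forall y : H, `|y| ^+ 2 = ip y y.
Variable T : {linear H -> H}.
Hypothesis T1 : forall y : H, `|T y| <= `|y|.
Variable x : H.

Let h n := ip (iter n T x) x.

Let G N (a : nat -> R[i]) := \sum_(m < N) a m *: iter m T x.

Let TZ c y : T (c *: y) = c *: T y.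
Proof. exact: linearZ_LR. Qed.

Let T_sum N (F : 'I_N -> H) : T (\sum_(m < N) F m) = \sum_(m < N) T (F m).
Proof. by apply: big_morph; [exact: raddfD|exact: raddf0]. Qed.

Let dot_suml N (F : 'I_N -> H) z : ip (\sum_(m < N) F m) z = \sum_(m < N) ip (F m) z.
Proof.
apply: (big_morph (fun v => ip v z)); last exact: linear0l.
by move=> u v; exact: linearDl.
Qed.

Let GS N a : G N.+1 a = a 0%N *: x + T (G N (fun m => a m.+1)).
Proof.
rewrite /G big_ord_recl; congr (_ + _).
by rewrite T_sum; apply: eq_bigr => m _; rewrite lift0 TZ.
Qed.

Let dotT y : ip (T y) (T y) <= ip y y.
Proof. by rewrite -!ipE lerXn2r ?nnegrE. Qed.

(* Peeling off the index 0 turns the Toeplitz form of [a] into that of its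
   shift, and [G] correspondingly into [T] of the shifted sum. *)
Let toeplitz_ge_dot N a : ip (G N a) (G N a) <=
  \sum_(m < N) \sum_(l < N) a m * Num.conj (a l) * hermitian_toeplitz h m l.
Proof.
elim: N a => [|N IH] a.
  by rewrite /G !big_ord0 linear0l.
rewrite GS (sum_square_recl (fun m l =>
  a m * Num.conj (a l) * hermitian_toeplitz h m l)).
set y := G N _; set u := a 0%N.
have yx : \sum_(m < N) a m.+1 * Num.conj u * hermitian_toeplitz h m.+1 0%N
    = Num.conj u * ip (T y) x.
  rewrite /y /G T_sum dot_suml mulr_sumr; apply: eq_bigr => m _.
  rewrite TZ dotZl /hermitian_toeplitz leq0n subn0 /h iterS; ring.
have xy : \sum_(l < N) u * Num.conj (a l.+1) * hermitian_toeplitz h 0%N l.+1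
    = u * ip x (T y).
  rewrite (dotC ip x) -[u in RHS]conjCK -rmorphM -yx rmorph_sum; apply: eq_bigr => l _.
  rewrite !rmorphM /= conjCK /hermitian_toeplitz /=; ring.
have rest : \sum_(m < N) \sum_(l < N) a m.+1 * Num.conj (a l.+1) *
    hermitian_toeplitz h m.+1 l.+1 =
    \sum_(m < N) \sum_(l < N) a m.+1 * Num.conj (a l.+1) * hermitian_toeplitz h m l.
  apply: eq_bigr => m _; apply: eq_bigr => l _.
  by rewrite /hermitian_toeplitz ltnS !subSS.
rewrite xy yx rest linearDl !linearDr /= !dotZl !dotZr.
have -> : hermitian_toeplitz h 0%N 0%N = ip x x by [].
rewrite -!addrA mulrA lerD2l lerD2l lerD2l.
exact: le_trans (dotT y) (IH _).
Qed.

(** The Toeplitz form dominates the squared norm of [\sum_m a m *: iter m T x]; this takes the place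
    of a unitary dilation of [T]. *)
Lemma contraction_positive_definite : x != 0 ->
  positive_definite (fun n => ip (iter n T x) x / ip x x).
Proof.
move=> x0 N a; have xx0 : 0 < ip x x by rewrite dnorm_gt0.
rewrite (_ : \sum_(m < N) _ = (\sum_(m < N) \sum_(l < N)
    a m * Num.conj (a l) * hermitian_toeplitz h m l) / ip x x).
  apply: divr_ge0; last exact: ltW.
  exact: le_trans (dnorm_ge0 ip _) (toeplitz_ge_dot N a).
rewrite mulr_suml; apply: eq_bigr => m _; rewrite mulr_suml; apply: eq_bigr => l _.
rewrite -[RHS]mulrA; congr (_ * _); rewrite /hermitian_toeplitz; case: ifP => // _.
by rewrite rmorphM fmorphV /= -(dotC ip x x).
Qed.

Lemma contraction_iter_le n : `|iter n T x| <= `|x|.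
Proof. by elim: n => //= n; apply: le_trans; exact: T1. Qed.

Lemma contraction_coef_le1 n : x != 0 -> `|ip (iter n T x) x / ip x x| <= 1.
Proof.
move=> x0; have xx0 : 0 < ip x x by rewrite dnorm_gt0.
rewrite normrM normfV [X in _ / X]gtr0_norm// ler_pdivrMr// mul1r.
rewrite -(@ler_pXn2r _ 2) ?nnegrE ?normr_ge0 ?(ltW xx0)//.
apply: (le_trans (dot_CauchySchwarz ip _ _)).
by rewrite expr2 ler_pM2r// -!ipE lerXn2r ?nnegrE// contraction_iter_le.
Qed.

End ContractionCoefficients.

Lemma extremal_hilbert_property (R : realType) (k : nat -> nat) :
  extremal R k -> hilbert_property R k.
Proof.
move=> ext H ip ipE T T1 x x0 kx; split=> //.
have nz : `|x| ^+ 2 != 0 by rewrite expf_neq0// normr_eq0.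
pose c n := ip (iter n T x) x / ip x x.
have ck : (fun n => `|c (k n)| : R[i]^o) @ \oo --> (1 : R[i]^o).
  have -> : (fun n => `|c (k n)| : R[i]^o) =
      (fun n => `|ip (iter (k n) T x) x| / `|x| ^+ 2).
    by apply/funext => n; rewrite normrM normfV -ipE normrX normr_id.
  exact: cvgC_divr nz kx.
have [||||a a1 ca] := @extremal_positive_definite R k c ext.
- exact: contraction_positive_definite.
- by rewrite /c /= divff// dnorm_eq0.
- by move=> n; exact: contraction_coef_le1.
- exact: ck.
exists a; split=> //; have := ca 1%N; rewrite expr1 => c1; rewrite -c1 /c /=.
apply: dot_CauchySchwarz_eq => //; first by rewrite -!ipE lerXn2r ?nnegrE.
have -> : ip (T x) x = a * ip x x by rewrite -c1 /c divfK// dnorm_eq0.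
by rewrite normrM a1 mul1r ger0_norm// dnorm_ge0.
Qed.

(** For unimodular [z] conjugation is inversion, so the Toeplitz matrix has rank one and its form is
    the square of a modulus. *)
Lemma toeplitz_unimodular (R : realType) (z : R[i]) m l : `|z| = 1 ->
  hermitian_toeplitz (fun n => z ^+ n) m l = z ^+ m * Num.conj (z ^+ l).
Proof.
move=> z1; have zz n : z ^+ n * Num.conj (z ^+ n) = 1.
  by rewrite -normCK normrX z1 !expr1n.
rewrite /hermitian_toeplitz; case: leqP => [lm|ml].
  by rewrite -{2}(subnK lm) exprD -mulrA zz mulr1.
by rewrite -{2}(subnK (ltnW ml)) exprD rmorphM mulrCA zz mulr1.
Qed.

(** The numbers [c n] are the coefficients of the measure with masses 1/2 at [z] and [w]; their form
    is half a sum of two squared moduli. *)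
Lemma extremal_two_points (R : realType) (k : nat -> nat) (z w : R[i]) :
  extremal R k -> `|z| = 1 -> `|w| = 1 ->
  (fun n => `|z ^+ k n + w ^+ k n| : R[i]^o) @ \oo --> (2 : R[i]^o) -> z = w.
Proof.
move=> ext z1 w1 kzw; pose c n := (z ^+ n + w ^+ n) / 2.
have [|||| a _ ca] := @extremal_positive_definite R k c ext.
- move=> N a; pose S (y : R[i]) := \sum_(m < N) a m * y ^+ m.
  rewrite (_ : \sum_(m < N) _ = (`|S z| ^+ 2 + `|S w| ^+ 2) / 2).
    by rewrite divr_ge0// addr_ge0// exprn_ge0.
  rewrite !normCK /S !rmorph_sum !mulr_suml -big_split /= mulr_suml.
  apply: eq_bigr => m _; rewrite !mulr_sumr -big_split /= mulr_suml.
  apply: eq_bigr => l _; rewrite !rmorphM /=.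
  have -> : hermitian_toeplitz c m l =
      (z ^+ m * Num.conj (z ^+ l) + w ^+ m * Num.conj (w ^+ l)) / 2.
    rewrite -!toeplitz_unimodular// /hermitian_toeplitz /c; case: ifP => // _.
    by rewrite rmorphM rmorphD fmorphV /= conjC_nat.
  ring.
- by rewrite /c !expr0 divff// pnatr_eq0.
- move=> n; rewrite normrM normfV normr_nat ler_pdivrMr// mul1r.
  by rewrite (le_trans (ler_normD _ _))// !normrX z1 w1 !expr1n.
- have -> : (fun n => `|c (k n)| : R[i]^o) = (fun n => `|z ^+ k n + w ^+ k n| / 2).
    by apply/funext => n; rewrite /c normrM normfV normr_nat.
  by apply: cvgC_divr => //; rewrite pnatr_eq0.
(* The coefficients at 1 and 2 suffice: they are [a] and [a ^+ 2], so the variance of the two-point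
   measure is 0. *)
apply/eqP; rewrite -subr_eq0 -sqrf_eq0; apply/eqP.
have e1 : z + w = 2 * a by have := ca 1%N; rewrite /c !expr1 => <-; field.
have e2 : z ^+ 2 + w ^+ 2 = 2 * a ^+ 2 by rewrite -ca /c; field.
have -> : (z - w) ^+ 2 = 2 * (z ^+ 2 + w ^+ 2) - (z + w) ^+ 2 by ring.
by rewrite e1 e2; ring.
Qed.

(** * Operators on Banach spaces *)

Section NullSequences.
Variable R : realType.

Definition null_seq (u : nat -> R[i]) :=
  forall e : R, 0 < e -> exists N, forall n, (N <= n)%N -> `|u n| < e%:C.

Lemma null_seqP (u : nat -> R[i]) (l : R[i]) :
  (u : nat -> R[i]^o) @ \oo --> (l : R[i]^o) <-> null_seq (fun n => u n - l).
Proof. exact: cvgCP. Qed.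

Lemma null_seqD u v : null_seq u -> null_seq v -> null_seq (fun n => u n + v n).
Proof.
move=> u0 v0 e e0; have e2 : 0 < e / 2 by rewrite divr_gt0.
have [N1 uN] := u0 _ e2; have [N2 vN] := v0 _ e2.
exists (maxn N1 N2) => n; rewrite geq_max => /andP[/uN un /vN vn].
by rewrite (le_lt_trans (ler_normD _ _))// [e]splitr rmorphD ltrD.
Qed.

Lemma null_seq_le (M : R) u v : 0 < M -> (forall n, `|v n| <= M%:C * `|u n|) ->
  null_seq u -> null_seq v.
Proof.
move=> M0 vu u0 e e0; have [N uN] := u0 _ (divr_gt0 e0 M0).
have M0' : 0 < M%:C :> R[i] by rewrite ltcR.
exists N => n /uN; rewrite rmorphM fmorphV /= mulrC ltr_pdivlMl//.
by move=> h; exact: le_lt_trans (vu n) h.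
Qed.

Lemma null_seqZ c u : null_seq u -> null_seq (fun n => c * u n).
Proof.
have [c0 cE] : 0 < complex.Re (`|c| + 1) /\ `|c| + 1 = (complex.Re (`|c| + 1))%:C.
  by apply: gt0_complexE; rewrite ltr_wpDl.
by apply: (null_seq_le c0) => n; rewrite -cE normrM ler_wpM2r// lerDl.
Qed.

Lemma null_seq_norm u v : (forall n, `|v n| <= `|u n|) -> null_seq u -> null_seq v.
Proof. by move=> vu; apply: (null_seq_le ltr01) => n; rewrite mul1r. Qed.

Lemma null_seqN u : null_seq u -> null_seq (fun n => - u n).
Proof. by apply: null_seq_norm => n; rewrite normrN. Qed.

Lemma null_seqB u v : null_seq u -> null_seq v -> null_seq (fun n => u n - v n).
Proof. by move=> u0 /null_seqN; exact: null_seqD. Qed.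

Lemma null_seq_sub u s : (forall n, n <= s n)%N -> null_seq u ->
  null_seq (fun n => u (s n)).
Proof.
move=> sn u0 e /u0[N uN]; exists N => n Nn.
by apply: uN; rewrite (leq_trans Nn).
Qed.

Lemma null_seq_cst c : null_seq (fun _ => c) -> c = 0.
Proof.
move=> c0; apply/eqP; apply/negPn/negP; rewrite -normr_gt0 => /gt0_complexE[n0 nE].
by have [N /(_ N (leqnn N))] := c0 _ n0; rewrite -nE ltxx.
Qed.

(** [|c|] equals [|c * u n| - |c| * (|u n| - 1)], a constant sequence that tends to 0. *)
Lemma null_seq_norm1 c u : null_seq (fun n => `|u n| - 1) ->
  null_seq (fun n => c * u n) -> c = 0.
Proof.
move=> u1 cu; apply/eqP; rewrite -normr_eq0; apply/eqP/null_seq_cst.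
have cu' : null_seq (fun n => `|c * u n|).
  by apply: null_seq_norm cu => n; rewrite normr_id.
have := null_seqD cu' (null_seqZ (- `|c|) u1); apply: null_seq_norm => n.
by rewrite normrM mulrBr mulr1 mulNr opprK addrA subrr add0r.
Qed.

End NullSequences.

Section BoundedFunctionals.
Variables (R : realType) (E : normedModType R[i]).

(** Continuous functionals as plain functions, so that sums, multiples and compositions with powers
    of [T] can be formed directly. *)
Definition bounded_functional (f : E -> R[i]) :=
  linear (f : E -> R[i]^o) /\ exists2 M : R, 0 < M & forall v, `|f v| <= M%:C * `|v|.

Lemma bounded_functionalP f : bounded_functional f ->
  exists2 F : {linear E -> R[i]^o}, continuous F & F =1 f.
Proof.
move=> [f_lin [M M0 fM]].
pose F : {linear E -> R[i]^o} := HB.pack f (GRing.isLinear.Build _ _ _ _ f f_lin).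
exists F => //; apply: bounded_linear_continuous; apply/linear_boundedP.
exists M%:C; split; first by rewrite realE ler0c ltW.
by move=> r /ltW Mr v; rewrite (le_trans (fM v))// ler_wpM2r.
Qed.

Lemma continuous_bounded_functional (F : {linear E -> R[i]^o}) :
  continuous F -> bounded_functional F.
Proof. by move=> cF; split; [exact: linearP|exact: linear_continuous_bound]. Qed.

Lemma bounded_functionalD f g : bounded_functional f -> bounded_functional g ->
  bounded_functional (fun v => f v + g v).
Proof.
move=> [fl [M M0 fM]] [gl [N N0 gN]]; split.
  move=> a u v; have -> : f (a *: u + v) = a * f u + f v by exact: fl.
  have -> : g (a *: u + v) = a * g u + g v by exact: gl.
  have -> : a *: ((f u + g u) : R[i]^o) = a * (f u + g u) by [].
  by rewrite /=; ring.
exists (M + N); first exact: addr_gt0.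
move=> v; rewrite rmorphD mulrDl (le_trans (ler_normD _ _))// lerD//.
Qed.

Lemma bounded_functionalZ c f : bounded_functional f ->
  bounded_functional (fun v => c * f v).
Proof.
move=> [fl [M M0 fM]]; split.
  move=> a u v; have -> : f (a *: u + v) = a * f u + f v by exact: fl.
  have -> : a *: ((c * f u) : R[i]^o) = a * (c * f u) by [].
  by rewrite /=; ring.
have [c0 cE] : 0 < complex.Re (`|c| + 1) /\ `|c| + 1 = (complex.Re (`|c| + 1))%:C.
  by apply: gt0_complexE; rewrite ltr_wpDl.
exists (complex.Re (`|c| + 1) * M); first exact: mulr_gt0.
move=> v; rewrite rmorphM /= -cE normrM -mulrA.
apply: ler_pM => //; first by rewrite lerDl.
Qed.

Lemma bounded_functional_comp (T : {linear E -> E}) f :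
  bounded_near T (nbhs (0 : E)) -> bounded_functional f ->
  bounded_functional (f \o T).
Proof.
move=> /linear_boundedP/pinfty_ex_gt0[K /gt0_complexE[K0 KE] TK] [fl [M M0 fM]].
split.
  move=> a u v /=; have -> : T (a *: u + v) = a *: T u + T v by exact: linearP.
  exact: fl.
exists (M * complex.Re K); first exact: mulr_gt0.
move=> v /=; rewrite (le_trans (fM _))// rmorphM /= -KE -mulrA ler_wpM2l//.
by rewrite ler0c ltW.
Qed.

Lemma bounded_functional_sum N (F : 'I_N -> E -> R[i]) :
  (forall i, bounded_functional (F i)) ->
  bounded_functional (fun v => \sum_(i < N) F i v).
Proof.
elim: N F => [|N IH] F hF.
  split; last by exists 1 => // v; rewrite big_ord0 normr0 mulr_ge0 ?ler0c.
  by move=> a u v; rewrite !big_ord0 scaler0 addr0.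
have -> : (fun v => \sum_(i < N.+1) F i v) =
    (fun v => F ord0 v + \sum_(i < N) F (lift ord0 i) v).
  by apply/funext => v; rewrite big_ord_recl.
by apply: bounded_functionalD => //; apply: IH.
Qed.

Lemma bounded_functional_iter (T : {linear E -> E}) f n :
  bounded_near T (nbhs (0 : E)) -> bounded_functional f ->
  bounded_functional (fun v => f (iter n T v)).
Proof.
move=> bT; elim: n f => //= n IH f hf; apply: (IH (f \o T)).
exact: bounded_functional_comp.
Qed.

Lemma bounded_functional_separation y : y != 0 ->
  exists2 f, bounded_functional f & f y = 1.
Proof.
move=> /hahn_banach_separation[F [cF Fy]]; exists (fun v => (F y)^-1 * F v).
  exact/bounded_functionalZ/continuous_bounded_functional.
by rewrite mulVf.
Qed.

End BoundedFunctionals.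

(** * Eigenvector decomposition when a power of the operator acts as a scalar *)

Section RootEigenvectors.
Variables (R : realType) (E : lmodType R[i]) (T : {linear E -> E}).

Lemma iter_linZ n c y : iter n T (c *: y) = c *: iter n T y.
Proof. by elim: n => //= n ->; exact: linearZ_LR. Qed.

Lemma iter_linD n u v : iter n T (u + v) = iter n T u + iter n T v.
Proof. by elim: n => //= n ->; exact: raddfD. Qed.

Lemma iter_lin_sum n N (F : 'I_N -> E) :
  iter n T (\sum_(i < N) F i) = \sum_(i < N) iter n T (F i).
Proof.
apply: (big_morph (iter n T)); first exact: iter_linD.
by elim: n => //= n ->; exact: raddf0.
Qed.

(** If [T^d x = z^d x], this is [d] times the component of [x] in the eigenspace of [z]. *)
Definition root_component d (x : E) (z : R[i]) :=
  \sum_(i < d) z ^- i *: iter i T x.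

(** Up to the factor [z], [T] permutes the summands cyclically: the summand of index [d] coincides
    with that of index 0. *)
Lemma root_componentP d x (mu z : R[i]) : z != 0 -> z ^+ d = mu ->
  iter d T x = mu *: x -> T (root_component d x z) = z *: root_component d x z.
Proof.
move=> z0 zd Tx; pose F i := z ^- i *: iter i T x.
have TF i : T (F i) = z *: F i.+1.
  rewrite /F [T _](iter_linZ 1) /= scalerA exprS invfM mulrA divff// mul1r.
  by [].
have Fd : F d = F 0%N.
  by rewrite /F Tx -zd scalerA mulVf ?expf_neq0// expr0 invr1.
rewrite [LHS](iter_lin_sum 1) /= -/(F _).
under eq_bigr do rewrite TF.
rewrite -scaler_sumr; congr (_ *: _).
have shiftF : \sum_(i < d.+1) F i = F 0%N + \sum_(i < d) F i.+1.
  by rewrite big_ord_recl.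
by move: shiftF; rewrite big_ord_recr /= Fd addrC => /addrI.
Qed.

(** The [z j] with [j < d] are the [d]-th roots of [mu]. Summed over them, the terms in [T^i x] with
    [0 < i < d] cancel by the orthogonality of roots of unity. *)
Lemma root_decomposition d x (mu : R[i]) : (0 < d)%N -> `|mu| = 1 ->
  iter d T x = mu *: x ->
  exists z : nat -> R[i], [/\ forall j, `|z j| = 1,
    forall i j, (i < j < d)%N -> z i != z j,
    forall j, T (root_component d x (z j)) = z j *: root_component d x (z j) &
    \sum_(j < d) root_component d x (z j) = d%:R *: x].
Proof.
move=> d0 mu1 Tx; pose r := d.-root mu.
have rd : r ^+ d = mu by exact: rootCK.
have r1 : `|r| = 1.
  by apply/eqP; rewrite -(@pexpr_eq1 _ _ d) -?normrX ?rd ?mu1.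
have r0 : r != 0 by rewrite -normr_gt0 r1.
have dR0 : d%:R != 0 :> R by rewrite pnatr_eq0 -lt0n.
have e0 (t : R) : expi t != 0 by rewrite -normr_gt0 norm_expi.
pose z j := r * expi (j%:R / d%:R : R).
have z0 j : z j != 0 by rewrite mulf_neq0.
have zd j : z j ^+ d = mu.
  have ej : expi (j%:R : R) = 1 by rewrite -[j%:R]mulr1 -expiX expi1 expr1n.
  by rewrite /z exprMn rd expiX [d%:R * _]mulrCA divff// mulr1 ej mulr1.
exists z; split.
- by move=> j; rewrite normrM r1 norm_expi mulr1.
- move=> i j /andP[ij jd]; apply/eqP => /(mulfI r0) zij.
  have : expi ((j - i)%:R / d%:R : R) == 1.
    rewrite natrB ?(ltnW ij)// mulrBl; apply/eqP/(mulIf (e0 (i%:R / d%:R))).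
    by rewrite mul1r -expiD subrK.
  rewrite expi_div_eq1// => /dvdn_leq; lia.
- by move=> j; apply: root_componentP.
rewrite exchange_big /= (bigD1 (Ordinal d0))//= [X in _ + X]big1 ?addr0.
  under eq_bigr do rewrite expr0 invr1 scale1r.
  by rewrite sumr_const card_ord scaler_nat.
move=> i i0; rewrite -scaler_suml.
pose w : R[i] := expi (d%:R^-1 : R) ^- i.
have zw j : z j ^- i = r ^- i * w ^+ j.
  rewrite /z exprMn invfM; congr (_ * _).
  by rewrite -expiX /w exprVn -!exprM mulnC.
under eq_bigr do rewrite zw.
rewrite -mulr_sumr sum_expi_root.
  rewrite /w invr_eq1 expiX expi_div_eq1// gtnNdvd ?mulr0 ?scale0r//.
  by rewrite lt0n.
by rewrite /w exprVn -exprM mulnC exprM expiX divff// expi1 expr1n invr1.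
Qed.

End RootEigenvectors.

Lemma extremal_banach_property (R : realType) (k : nat -> nat) :
  subsequence k -> (liminf_gap R k < +oo)%E -> extremal R k -> banach_property R k.
Proof.
move=> [_ [n0 k_incr]] /liminf_gap_ltyP[g gap] ext E T bT x x0 kT; split=> //.
have {}kT f : bounded_functional f ->
    null_seq (fun n => `|f (iter (k n) T x)| - `|f x|).
  move=> /bounded_functionalP[F cF Ff]; have /null_seqP := kT F cF.
  by under eq_fun do rewrite !Ff.
have [f0 hf0 f0x] := bounded_functional_separation x0.
pose a n := f0 (iter (k n) T x).
have a1 : null_seq (fun n => `|a n| - 1) by have := kT _ hf0; rewrite f0x normr1.
(* The hypothesis is applied to [f - f x * f0], which vanishes at [x]. *)
have fa f : bounded_functional f -> null_seq (fun n => f (iter (k n) T x) - f x * a n).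
  move=> hf; pose h v := f v + (- f x) * f0 v.
  have hh : bounded_functional h.
    by apply: bounded_functionalD => //; exact: bounded_functionalZ.
  have := kT h hh; rewrite /h f0x mulr1 subrr normr0; apply: null_seq_norm => n.
  by rewrite subr0 normr_id mulNr.
(* Pigeonhole: infinitely many gaps lie below [g]. If each value below [g] occurred only up to some
   index [b d], no such gap would exist beyond the maximum of these indices. *)
have [d d0 kd] : exists2 d, (0 < d)%N &
    forall N, exists2 n, (N <= n)%N & k n.+1 = (k n + d)%N.
  apply: contrapT => nod.
  have bad (d : 'I_g) : exists N, forall n, (N <= n)%N -> k n.+1 <> (k n + d)%N.
    have [d0|d0] := posnP d.
      exists n0 => n n0n; have := k_incr n n.+1 n0n (ltnSn n); rewrite d0; lia.
    apply: contrapT => /forallNP kd; apply: nod; exists (d : nat) => // N.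
    by have /existsNP[n /not_implyP[Nn /contrapT]] := kd N; exists n.
  have [b hb] := choice bad.
  have [n nb kn] := gap (maxn n0 (\max_(d < g) b d)).
  have kn' := k_incr n n.+1 (leq_trans (leq_maxl _ _) nb) (ltnSn n).
  have dg : (k n.+1 - k n < g)%N by rewrite ltn_subLR// ltnW.
  apply: (hb (Ordinal dg) n); last by rewrite /= subnKC// ltnW.
  by rewrite (leq_trans _ nb)// leq_max (leq_bigmax (Ordinal dg)) orbT.
have kd' n : exists m, (n <= m)%N /\ k m.+1 = (k m + d)%N.
  by have [m] := kd n; exists m.
have [s sP] := choice kd'.
have s_ge n : (n <= s n)%N by have [] := sP n.
have s1_ge n : (n <= (s n).+1)%N by rewrite ltnW// ltnS.
(* Since [k (s n).+1 = k (s n) + d], the asymptotics of [f] at [(s n).+1] and of [f \o T^d] at [s n]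
   describe the same numbers. *)
have shift f : bounded_functional f ->
    null_seq (fun n => f x * a (s n).+1 - f (iter d T x) * a (s n)).
  move=> hf.
  have h1 := null_seq_sub s_ge (fa _ (bounded_functional_iter d bT hf)).
  have h2 := null_seq_sub s1_ge (fa _ hf).
  apply: null_seq_norm (null_seqB h1 h2) => n.
  rewrite (sP n).2 addnC iterD.
  by rewrite le_eqVlt; apply/orP; left; apply/eqP; congr `|_|; ring.
pose mu := f0 (iter d T x).
have shift0 := shift _ hf0; rewrite f0x -/mu in shift0.
have a1s := null_seq_sub s_ge a1; have a1s1 := null_seq_sub s1_ge a1.
(* A functional with value 1 at [T^d x - mu x] would force [a (s n)] to tend to 0, although its
   modulus tends to 1. *)
have Tdx : iter d T x = mu *: x.
  apply/eqP; rewrite -subr_eq0; apply/negPn/negP => /bounded_functional_separation[f hf].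
  have fl c u v : f (c *: u + v) = c * f u + f v by exact: hf.1.
  rewrite addrC -scaleNr fl => fy.
  have : (1 : R[i]) = 0; last by apply/eqP; rewrite oner_eq0.
  apply: (null_seq_norm1 a1s); rewrite -fy.
  apply: null_seq_norm (null_seqB (null_seqZ (f x) shift0) (shift _ hf)) => n.
  by rewrite le_eqVlt; apply/orP; left; apply/eqP; congr `|_|; ring.
have mu1 : `|mu| = 1.
  apply/eqP; rewrite eq_sym -subr_eq0; apply/eqP/null_seq_cst.
  have h1 : null_seq (fun n => `|a (s n).+1| - `|mu * a (s n)|).
    apply: null_seq_norm shift0 => n; rewrite mul1r.
    exact: ler_dist_dist.
  have := null_seqD (null_seqB h1 a1s1) (null_seqZ `|mu| a1s).
  apply: null_seq_norm => n; rewrite normrM le_eqVlt; apply/orP; left; apply/eqP.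
  by congr `|_|; ring.
have [z [z1 zinj Tz zsum]] := root_decomposition d0 mu1 Tdx.
pose y j := root_component T d x (z j).
have iter_y n j : iter n T (y j) = z j ^+ n *: y j.
  elim: n => [|n IH]; first by rewrite scale1r.
  by rewrite /= IH [T _](iter_linZ T 1) /= Tz scalerA -exprSr.
have uniq i j : (i < j < d)%N -> y i != 0 -> y j != 0 -> False.
  move=> ijd /bounded_functional_separation[f hf fy] /bounded_functional_separation[f' hf' fy'].
  (* [p z' f''] evaluates [f''] on the root component of its argument. At [T^n x] and [z j] this is
     [z j ^+ n * f'' (y j)], so the sum of two such functionals isolates [z i ^+ n + z j ^+ n]. *)
  pose p (z' : R[i]) (f'' : E -> R[i]) v := \sum_(l < d) z' ^- l * f'' (iter l T v).
  have hp z' f'' : bounded_functional f'' -> bounded_functional (p z' f'').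
    move=> hf''; apply: bounded_functional_sum => l; apply: bounded_functionalZ.
    exact: bounded_functional_iter.
  have pE j' f'' n : bounded_functional f'' ->
      p (z j') f'' (iter n T x) = z j' ^+ n * f'' (y j').
    move=> hf''; have fl c u v : f'' (c *: u + v) = c * f'' u + f'' v by exact: hf''.1.
    have f0' : f'' 0 = 0 by have := fl (-1) 0 0; rewrite scaler0 addr0 mulN1r addNr.
    have fZ c u : f'' (c *: u) = c * f'' u by rewrite -[c *: u]addr0 fl f0' addr0.
    have fD u v : f'' (u + v) = f'' u + f'' v by rewrite -[u]scale1r fl mul1r scale1r.
    rewrite -fZ -iter_y /y /root_component iter_lin_sum (big_morph f'' fD f0').
    by apply: eq_bigr => l _; rewrite iter_linZ fZ -!iterD addnC.
  have hh := bounded_functionalD (hp (z i) _ hf) (hp (z j) _ hf').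
  have := kT _ hh; rewrite (pE _ _ 0%N hf) (pE _ _ 0%N hf') !expr0 fy fy' !mulr1.
  under eq_fun do rewrite !pE// fy fy' !mulr1.
  move=> h; have /eqP := zinj _ _ ijd; apply.
  apply: (extremal_two_points ext (z1 i) (z1 j)).
  have n2 : `|1 + 1 : R[i]| = 2 by rewrite -[1 + 1]/(2%:R) normr_nat.
  by apply/null_seqP; rewrite n2 in h.
have [j yj] : exists j : 'I_d, y j != 0.
  apply: contrapT => /forallNP y0; move: x0; apply/negP/negPn.
  have : d%:R *: x == 0.
    by rewrite -zsum big1// => j _; apply/eqP/negPn/negP; exact: y0.
  by rewrite scaler_eq0 pnatr_eq0 eqn0Ngt d0.
have xy : y j = d%:R *: x.
  rewrite -zsum (bigD1 j)//= big1 ?addr0// => i ij.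
  apply/eqP/negPn/negP => yi.
  have [lt|gt|/val_inj e] := ltngtP i j.
  - by apply: (@uniq i j) => //; rewrite lt ltn_ord.
  - by apply: (@uniq j i) => //; rewrite gt ltn_ord.
  - by rewrite e eqxx in ij.
exists (z j); split=> //.
have d0' : d%:R != 0 :> R[i] by rewrite pnatr_eq0 -lt0n.
apply: (scalerI d0'); rewrite -[LHS](iter_linZ T 1) /= -xy Tz.
by rewrite -/(y j) xy !scalerA mulrC.
Qed.

(** * Completion of semi-inner product spaces *)

Section SemiInnerProducts.
Variable R : realType.

(** Degenerate forms are allowed: functions vanishing almost everywhere have length 0. *)
Record semi_dot (V : lmodType R[i]) := SemiDot {
  sdot :> V -> V -> R[i];
  sdotP : forall a u v w, sdot (a *: u + v) w = a * sdot u w + sdot v w;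
  sdotC : forall u v, sdot u v = Num.conj (sdot v u);
  sdot_ge0 : forall u, 0 <= sdot u u }.

Variables (V : lmodType R[i]) (B : semi_dot V).

Lemma sdot0l w : B 0 w = 0.
Proof. by have := sdotP B (-1) 0 0 w; rewrite scaler0 addr0 mulN1r addNr. Qed.

Lemma sdotZl a u w : B (a *: u) w = a * B u w.
Proof. by rewrite -[a *: u]addr0 sdotP sdot0l addr0. Qed.

Lemma sdotDl u v w : B (u + v) w = B u w + B v w.
Proof. by rewrite -[u]scale1r sdotP mul1r scale1r. Qed.

Lemma sdotBl u v w : B (u - v) w = B u w - B v w.
Proof. by rewrite sdotDl -scaleN1r sdotZl mulN1r. Qed.

Lemma sdotZr a u w : B u (a *: w) = Num.conj a * B u w.
Proof. by rewrite (sdotC B) sdotZl rmorphM /= -(sdotC B). Qed.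

Lemma sdotBr u v w : B u (v - w) = B u v - B u w.
Proof. by rewrite (sdotC B) sdotBl rmorphB /= -!(sdotC B). Qed.

Lemma sdotDr u v w : B u (v + w) = B u v + B u w.
Proof. by rewrite (sdotC B) sdotDl rmorphD /= -!(sdotC B). Qed.

Definition snorm u : R[i] := sqrtC (B u u).

Lemma snorm_ge0 u : 0 <= snorm u.
Proof. by rewrite sqrtC_ge0 sdot_ge0. Qed.

Lemma snorm2 u : snorm u ^+ 2 = B u u.
Proof. exact: sqrtCK. Qed.

Lemma sdot_conj u : Num.conj (B u u) = B u u.
Proof. by rewrite -(sdotC B). Qed.

Lemma sdot_CauchySchwarz u v : `|B u v| <= snorm u * snorm v.
Proof.
rewrite -(@ler_pXn2r _ 2) ?nnegrE ?mulr_ge0 ?snorm_ge0// exprMn !snorm2.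
(* Positivity of [B] at [u - (t * B u v) *: v], with [t] still to be chosen. *)
have main t : `|B u v| ^+ 2 * (t + Num.conj t) <=
    B u u + t * Num.conj t * `|B u v| ^+ 2 * B v v.
  have := sdot_ge0 B (u - (t * B u v) *: v).
  rewrite sdotBl !sdotBr !sdotZl !sdotZr (sdotC B v u) !rmorphM /= normCK => h.
  by rewrite -subr_ge0; apply: (le_trans h); rewrite le_eqVlt; apply/orP; left; apply/eqP; ring.
have [v0|v0] := eqVneq (B v v) 0.
  have [->|b0] := eqVneq (B u v) 0; first by rewrite normr0 expr0n mulr_ge0// sdot_ge0.
  have n0 : 0 < `|B u v| ^+ 2 by rewrite exprn_gt0// normr_gt0.
  (* When [B v v] is 0, this [t] makes the left side of [main] equal to [B u u + 1], while the right
     side is [B u u]. *)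
  pose t := (B u u + 1) / `|B u v| ^+ 2 / 2.
  have tr : Num.conj t = t.
    apply/CrealP/ger0_real; rewrite !divr_ge0 ?exprn_ge0 ?addr_ge0//.
    exact: sdot_ge0.
  have tt : `|B u v| ^+ 2 * (t + t) = B u u + 1.
    by rewrite /t -splitr mulrC divfK ?gt_eqF.
  by have := main t; rewrite v0 mulr0 addr0 tr tt gerDl ler10.
have v0' : 0 < B v v by rewrite lt_def v0 sdot_ge0.
have vi : Num.conj (B v v)^-1 = (B v v)^-1 by rewrite fmorphV /= sdot_conj.
have e : (B v v)^-1 * (B v v)^-1 * `|B u v| ^+ 2 * B v v = `|B u v| ^+ 2 / B v v.
  by field.
by have := main (B v v)^-1; rewrite vi e mulrDr lerD2r ler_pdivrMr.
Qed.

Lemma snormD u v : snorm (u + v) <= snorm u + snorm v.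
Proof.
rewrite -(@ler_pXn2r _ 2) ?nnegrE ?addr_ge0 ?snorm_ge0// sqrrD !snorm2.
rewrite sdotDl !sdotDr addrA lerD2r -addrA lerD2l mulr2n (sdotC B v u).
have CS := sdot_CauchySchwarz u v.
have : B u v + Num.conj (B u v) <= `|B u v| + `|B u v|.
  have -> : `|B u v| + `|B u v| = `|B u v| + `|Num.conj (B u v)| by rewrite norm_conjC.
  apply: le_trans (ler_normD _ _); apply: real_ler_norm.
  by apply/CrealP; rewrite rmorphD /= conjCK addrC.
by move=> /le_trans; apply; rewrite lerD.
Qed.

Lemma snormZ a u : snorm (a *: u) = `|a| * snorm u.
Proof.
rewrite /snorm sdotZl sdotZr mulrA -normCK sqrtCM ?qualifE/= ?sdot_ge0 ?exprn_ge0//.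
by rewrite sqrCK.
Qed.

(** Testing with [w = u] suffices. This turns uniform estimates on functionals [B u] into norm
    estimates on [u]. *)
Lemma snorm_dual_le u (e : R[i]) : 0 <= e ->
  (forall w, `|B u w| <= e * snorm w) -> snorm u <= e.
Proof.
move=> e0 /(_ u); rewrite ger0_norm ?sdot_ge0// -snorm2 expr2.
have [->//|u0] := eqVneq (snorm u) 0.
by rewrite ler_pM2r// lt_def u0 snorm_ge0.
Qed.

End SemiInnerProducts.

Lemma cauchy_null_seq (R : realType) (u : nat -> R[i]) :
  (forall e : R, 0 < e -> exists N, forall n m, (N <= n)%N -> (N <= m)%N ->
     `|u n - u m| < e%:C) ->
  exists l, null_seq (fun n => u n - l).
Proof.
move=> uC.
have cvgR (f : R[i] -> R) : (forall z w, `|f z - f w|%:C <= `|z - w|) ->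
    exists l : R, forall e, 0 < e -> exists N, forall n, (N <= n)%N -> `|f (u n) - l| < e.
  move=> f1; have /cauchy_cvgP/cvg_ex[l fl] : cauchy ((fun n => f (u n)) @ \oo).
    apply/cauchy_exP => e e0; have [N uN] := uC e e0.
    exists (f (u N)); exists N => // n /= Nn; rewrite /ball /= -ltcR.
    exact: le_lt_trans (f1 _ _) (uN _ _ (leqnn _) Nn).
  exists l => e e0; have /cvgrPdist_lt/(_ _ e0)[N _ fN] := fl.
  by exists N => n Nn; rewrite distrC; exact: fN.
have [a ua] := cvgR _ (@complex_dist_Re R); have [b ub] := cvgR _ (@complex_dist_Im R).
exists (a +i* b) => e e0; have e2 : 0 < e / 2 by rewrite divr_gt0.
have [N1 uN1] := ua _ e2; have [N2 uN2] := ub _ e2.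
exists (maxn N1 N2) => n; rewrite geq_max => /andP[/uN1 n1 /uN2 n2].
rewrite [_ - _]complexE (le_lt_trans (ler_normD _ _))// normrM norm_i mul1r !normc_real.
rewrite [e]splitr rmorphD; move: n1 n2; case: (u n) => c d /= n1 n2.
by apply: ltrD; rewrite ltcR.
Qed.

Lemma null_seq_ge0 (R : realType) (u : nat -> R[i]) (l : R[i]) :
  (forall n, 0 <= u n) -> null_seq (fun n => u n - l) -> 0 <= l.
Proof.
move=> u0 ul; rewrite lecE /=; apply/andP; split.
  rewrite -normr_le0; apply/ler_addgt0Pr => e e0; rewrite add0r -lecR.
  have [N /(_ N (leqnn N)) uN] := ul _ e0; apply: le_trans (ltW uN).
  by apply: le_trans (complex_dist_Im _ _); rewrite (ger0_Im (u0 N)) sub0r normrN.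
rewrite -oppr_le0; apply/ler_addgt0Pr => e e0; rewrite add0r -lecR.
have [N /(_ N (leqnn N)) uN] := ul _ e0; apply: le_trans (ltW uN).
apply: le_trans (complex_dist_Re _ _); rewrite lecR (le_trans _ (ler_norm _))//.
by rewrite lerBrDr addNr; have := u0 N; rewrite lecE /= => /andP[].
Qed.

(* The completion of a semi-inner product space is realized inside its dual:
   it consists of the functionals that are norm limits of the [B v]. *)
Section Completion.
Variables (R : realType) (V : lmodType R[i]) (B : semi_dot V).

Definition approximable : {pred V -> R[i]^o} := fun phi =>
  `[< forall e : R, 0 < e ->
      exists v, forall w, `|phi w - B v w| <= e%:C * snorm B w >].

Lemma approximable_submod : submod_closed approximable.
Proof.
split=> [|a phi psi /asboolP hphi /asboolP hpsi].
  apply/asboolP => e e0; exists 0 => w.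
  by rewrite sdot0l subr0 normr0 mulr_ge0 ?snorm_ge0// ler0c ltW.
apply/asboolP => e e0.
have [a0 aE] : 0 < complex.Re (`|a| + 1) /\ `|a| + 1 = (complex.Re (`|a| + 1))%:C.
  by apply: gt0_complexE; rewrite ltr_wpDl.
have e2 : 0 < e / 2 by rewrite divr_gt0.
have [u hu] := hphi _ (divr_gt0 e2 a0); have [v hv] := hpsi _ e2.
exists (a *: u + v) => w; rewrite sdotP.
have -> : (a *: phi + psi) w - (a * B u w + B v w) =
    a * (phi w - B u w) + (psi w - B v w).
  have -> : (a *: phi + psi) w = a * phi w + psi w by [].
  by ring.
rewrite (le_trans (ler_normD _ _))// [e]splitr rmorphD mulrDl lerD//= normrM.
have a1 : 0 < `|a| + 1 by rewrite ltr_wpDl.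
apply: (@le_trans _ _ ((`|a| + 1) * `|phi w - B u w|)).
  by rewrite ler_wpM2r// lerDl.
rewrite (le_trans (ler_wpM2l (ltW a1) (hu w)))// {1}aE mulrA -rmorphM /=.
by rewrite [_ * (e / 2 / _)]mulrC divfK// gt_eqF.
Qed.

HB.instance Definition _ :=
  GRing.isSubmodClosed.Build R[i] (V -> R[i]^o) approximable approximable_submod.

Record completion := Completion {
  cval :> V -> R[i]^o; _ : cval \in approximable }.

HB.instance Definition _ := [isSub for cval].
HB.instance Definition _ := [Choice of completion by <:].
HB.instance Definition _ := [SubChoice_isSubLmodule of completion by <:].

End Completion.

Section CompletionDot.
Variables (R : realType) (V : lmodType R[i]) (B : semi_dot V).
Implicit Types (phi psi chi : completion B) (u v w : nat -> V).

Lemma cvalP phi e : 0 < e ->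
  exists x, forall y, `|phi y - B x y| <= e%:C * snorm B y.
Proof. by move=> e0; case: phi => f /= /asboolP; apply. Qed.

Lemma cvalD phi psi x : (phi + psi) x = phi x + psi x.
Proof. by []. Qed.

Lemma cvalZ a phi x : (a *: phi) x = a * phi x.
Proof. by []. Qed.

Lemma cvalN phi x : (- phi) x = - phi x.
Proof. by []. Qed.

Lemma completion_ext phi psi : (forall x, phi x = psi x) -> phi = psi.
Proof. by move=> h; apply/val_inj/funext. Qed.

(** [B x] is conjugate linear as a function of its argument, which makes the embedding linear in
    [x]. *)
Definition embed (x : V) : completion B.
Proof.
exists (B x : V -> R[i]^o); apply/asboolP => e e0; exists x => y.
by rewrite subrr normr0 mulr_ge0 ?snorm_ge0// ler0c ltW.
Defined.

Lemma embedE x y : embed x y = B x y. Proof. by []. Qed.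

Definition approx phi v := forall e : R, 0 < e -> exists N, forall n, (N <= n)%N ->
  forall x, `|phi x - B (v n) x| <= e%:C * snorm B x.

Lemma approx_ex phi : exists v, approx phi v.
Proof.
have h (n : nat) : exists x, forall y, `|phi y - B x y| <= (n.+1%:R^-1)%:C * snorm B y.
  by apply: cvalP; rewrite invr_gt0.
have [v hv] := choice h; exists v => e e0; exists (Num.trunc e^-1) => n Nn x.
rewrite (le_trans (hv n x))// ler_wpM2r ?snorm_ge0// lecR invf_ple ?posrE//.
by rewrite ltW// (lt_le_trans (truncnS_gt _))// ler_nat.
Qed.

Lemma approx_embed x : approx (embed x) (fun _ => x).
Proof.
move=> e e0; exists 0%N => n _ y.
by rewrite subrr normr0 mulr_ge0 ?snorm_ge0// ler0c ltW.
Qed.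

Lemma approxD phi psi u v : approx phi u -> approx psi v ->
  approx (phi + psi) (fun n => u n + v n).
Proof.
move=> hu hv e e0; have e2 : 0 < e / 2 by rewrite divr_gt0.
have [N1 h1] := hu _ e2; have [N2 h2] := hv _ e2.
exists (maxn N1 N2) => n; rewrite geq_max => /andP[/h1 {}h1 /h2 {}h2] x.
rewrite cvalD sdotDl opprD addrACA (le_trans (ler_normD _ _))//.
by rewrite [e]splitr rmorphD mulrDl lerD.
Qed.

Lemma approxZ a phi u : approx phi u -> approx (a *: phi) (fun n => a *: u n).
Proof.
move=> hu e e0.
have [a0 aE] : 0 < complex.Re (`|a| + 1) /\ `|a| + 1 = (complex.Re (`|a| + 1))%:C.
  by apply: gt0_complexE; rewrite ltr_wpDl.
have [N h] := hu _ (divr_gt0 e0 a0); exists N => n /h {}h x.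
rewrite cvalZ sdotZl -mulrBr normrM.
apply: (@le_trans _ _ ((`|a| + 1) * `|phi x - B (u n) x|)).
  by rewrite ler_wpM2r// lerDl.
have a1 : 0 <= `|a| + 1 by rewrite addr_ge0.
rewrite (le_trans (ler_wpM2l a1 (h x)))// {1}aE mulrA -rmorphM /=.
by rewrite [_ * (e / _)]mulrC divfK// gt_eqF.
Qed.

Lemma approx_dist phi u v e : 0 < e -> approx phi u -> approx phi v ->
  exists N, forall n m, (N <= n)%N -> (N <= m)%N -> snorm B (u n - v m) <= e%:C.
Proof.
move=> e0 hu hv; have e2 : 0 < e / 2 by rewrite divr_gt0.
have [N1 h1] := hu _ e2; have [N2 h2] := hv _ e2.
exists (maxn N1 N2) => n m; rewrite !geq_max => /andP[/h1 {}h1 _] /andP[_ /h2 {}h2].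
apply: snorm_dual_le => [|x]; first by rewrite ler0c ltW.
have -> : B (u n - v m) x = (phi x - B (v m) x) - (phi x - B (u n) x).
  by rewrite sdotBl; ring.
by rewrite (le_trans (ler_normB _ _))// [e]splitr rmorphD mulrDl lerD.
Qed.

Lemma approx_bounded phi u : approx phi u -> exists2 M : R, 0 < M &
  exists N, forall n, (N <= n)%N -> snorm B (u n) <= M%:C.
Proof.
move=> hu; have [N hN] := approx_dist ltr01 hu hu.
have [M0 ME] : 0 < complex.Re (snorm B (u N) + 1) /\
    snorm B (u N) + 1 = (complex.Re (snorm B (u N) + 1))%:C.
  by apply: gt0_complexE; rewrite ltr_wpDl// snorm_ge0.
exists (complex.Re (snorm B (u N) + 1)) => //; exists N => n Nn.
rewrite -ME -[u n](subrK (u N)) (le_trans (snormD _ _ _))// addrC lerD2l.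
exact: hN.
Qed.

(** Two pairs of representing sequences are compared at once: equal pairs give convergence of the
    inner products, different ones give independence of the choice. *)
Lemma approx_dot_cauchy phi psi u u' v v' e : 0 < e ->
  approx phi u -> approx phi u' -> approx psi v -> approx psi v' ->
  exists N, forall n m, (N <= n)%N -> (N <= m)%N ->
    `|B (u n) (v n) - B (u' m) (v' m)| < e%:C.
Proof.
move=> e0 hu hu' hv hv'.
have [M M0 [N1 h1]] := approx_bounded hv; have [M' M0' [N2 h2]] := approx_bounded hu'.
have d1 : 0 < e / 4 / M by rewrite !divr_gt0.
have d2 : 0 < e / 4 / M' by rewrite !divr_gt0.
have [N3 h3] := approx_dist d1 hu hu'; have [N4 h4] := approx_dist d2 hv hv'.
exists (maxn (maxn N1 N2) (maxn N3 N4)) => n m; rewrite !geq_max.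
move=> /andP[/andP[n1 _] /andP[n3 n4]] /andP[/andP[_ m2] /andP[m3 m4]].
have -> : B (u n) (v n) - B (u' m) (v' m) =
    B (u n - u' m) (v n) + B (u' m) (v n - v' m).
  by rewrite sdotBl sdotBr; ring.
rewrite (le_lt_trans (ler_normD _ _))//.
have b1 : `|B (u n - u' m) (v n)| <= (e / 4)%:C.
  rewrite (le_trans (sdot_CauchySchwarz _ _ _))//.
  rewrite (_ : e / 4 = e / 4 / M * M); last by rewrite divfK// gt_eqF.
  by rewrite rmorphM ler_pM ?snorm_ge0 ?h1 ?h3.
have b2 : `|B (u' m) (v n - v' m)| <= (e / 4)%:C.
  rewrite (le_trans (sdot_CauchySchwarz _ _ _))//.
  rewrite (_ : e / 4 = M' * (e / 4 / M')); last by rewrite [RHS]mulrC divfK// gt_eqF.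
  by rewrite rmorphM ler_pM ?snorm_ge0 ?h2 ?h4.
rewrite (le_lt_trans (lerD b1 b2))// -rmorphD ltcR /=; lra.
Qed.

Lemma completion_dot_ex phi psi : exists l, forall u v, approx phi u -> approx psi v ->
  null_seq (fun n => B (u n) (v n) - l).
Proof.
have [u0 hu0] := approx_ex phi; have [v0 hv0] := approx_ex psi.
have [|l hl] := @cauchy_null_seq R (fun n => B (u0 n) (v0 n)).
  by move=> e e0; exact: (approx_dot_cauchy e0 hu0 hu0 hv0 hv0).
exists l => u v hu hv e e0; have e2 : 0 < e / 2 by rewrite divr_gt0.
have [N1 h1] := hl _ e2; have [N2 h2] := approx_dot_cauchy e2 hu hu0 hv hv0.
exists (maxn N1 N2) => n; rewrite geq_max => /andP[n1 n2].
rewrite -[_ - l](subrKA (B (u0 n) (v0 n))) (le_lt_trans (ler_normD _ _))//.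
by rewrite [e]splitr rmorphD ltrD// ?h2 ?h1.
Qed.

Definition completion_dot phi psi : R[i] := projT1 (cid (completion_dot_ex phi psi)).

Lemma completion_dotP phi psi u v : approx phi u -> approx psi v ->
  null_seq (fun n => B (u n) (v n) - completion_dot phi psi).
Proof. exact: (projT2 (cid (completion_dot_ex phi psi))). Qed.

Lemma completion_dot_unique phi psi u v l : approx phi u -> approx psi v ->
  null_seq (fun n => B (u n) (v n) - l) -> completion_dot phi psi = l.
Proof.
move=> hu hv hl; apply/eqP; rewrite -subr_eq0; apply/eqP/null_seq_cst.
apply: null_seq_norm (null_seqB hl (completion_dotP hu hv)) => n.
by rewrite le_eqVlt; apply/orP; left; apply/eqP; congr `|_|; ring.
Qed.

Lemma completion_dot_linear a phi psi chi :
  completion_dot (a *: phi + psi) chi =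
  a * completion_dot phi chi + completion_dot psi chi.
Proof.
have [u hu] := approx_ex phi; have [v hv] := approx_ex psi; have [w hw] := approx_ex chi.
apply: (completion_dot_unique (approxD (approxZ a hu) hv) hw).
apply: null_seq_norm (null_seqD (null_seqZ a (completion_dotP hu hw)) (completion_dotP hv hw)).
move=> n; rewrite sdotP le_eqVlt; apply/orP; left; apply/eqP; congr `|_|; ring.
Qed.

Lemma completion_dotC phi psi :
  completion_dot phi psi = Num.conj (completion_dot psi phi).
Proof.
have [u hu] := approx_ex phi; have [v hv] := approx_ex psi.
apply: (completion_dot_unique hu hv).
apply: null_seq_norm (completion_dotP hv hu) => n.
by rewrite (sdotC B) -rmorphB norm_conjC.
Qed.

Lemma completion_dot_ge0 phi : 0 <= completion_dot phi phi.
Proof.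
have [u hu] := approx_ex phi.
exact: null_seq_ge0 (fun n => sdot_ge0 B (u n)) (completion_dotP hu hu).
Qed.

Definition completion_semi_dot : semi_dot (completion B) :=
  SemiDot completion_dot_linear completion_dotC completion_dot_ge0.

(** The Riesz representation of evaluation at [x]: along a representing sequence the inner product
    is [B (u n) x], which tends to [phi x]. *)
Lemma completion_dot_embed phi x : completion_dot phi (embed x) = phi x.
Proof.
have [u hu] := approx_ex phi; apply: (completion_dot_unique hu (approx_embed x)).
move=> e e0.
have [s0 sE] : 0 < complex.Re (snorm B x + 1) /\
    snorm B x + 1 = (complex.Re (snorm B x + 1))%:C.
  by apply: gt0_complexE; rewrite ltr_wpDl// snorm_ge0.
have [N h] := hu _ (divr_gt0 e0 s0); exists N => n /h {}h.
rewrite distrC (le_lt_trans (h x))//.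
have e0' : 0 < (e / complex.Re (snorm B x + 1))%:C by rewrite ltcR divr_gt0.
apply: (@lt_le_trans _ _ ((e / complex.Re (snorm B x + 1))%:C * (snorm B x + 1))).
  by rewrite ltr_pM2l// ltrDl.
by rewrite sE -rmorphM /= divfK// gt_eqF.
Qed.

Notation cnorm := (snorm completion_semi_dot).

Lemma cnorm_embed x : cnorm (embed x) = snorm B x.
Proof. by rewrite /snorm /= completion_dot_embed. Qed.

Lemma cval_le phi x : `|phi x| <= cnorm phi * snorm B x.
Proof.
by rewrite -completion_dot_embed -cnorm_embed (sdot_CauchySchwarz completion_semi_dot).
Qed.

(** Together with [cval_le] this identifies the norm with the dual norm. Vectors representing [phi]
    eventually have norm at most [e + t] for each [t > 0], and the squares of their norms converge
    to that of [phi]. *)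
Lemma cnorm_le phi (e : R) : 0 <= e ->
  (forall x, `|phi x| <= e%:C * snorm B x) -> cnorm phi <= e%:C.
Proof.
move=> e0 phie.
rewrite -(@ler_pXn2r _ 2) ?nnegrE ?snorm_ge0 ?ler0c// snorm2 /=.
have [u hu] := approx_ex phi.
have u_le d : 0 < d -> exists N, forall n, (N <= n)%N -> snorm B (u n) <= (e + d)%:C.
  move=> d0; have [N h] := hu _ d0; exists N => n /h {}h.
  apply: snorm_dual_le => [|x]; first by rewrite ler0c addr_ge0// ltW.
  have -> : B (u n) x = phi x - (phi x - B (u n) x) by ring.
  by rewrite (le_trans (ler_normB _ _))// rmorphD mulrDl lerD.
have dotr : completion_dot phi phi = (complex.Re (completion_dot phi phi))%:C.
  by rewrite RRe_real// ger0_real// completion_dot_ge0.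
rewrite dotr -rmorphXn lecR /=; apply/ler_addgt0Pr => d d0.
have c0 : 0 < e *+ 2 + 1 by rewrite ltr_wpDl// mulrn_wge0.
(* From [t <= 1] and [t * (2 e + 1) <= d / 2] follows [(e + t)^2 <= e^2 + d / 2]. *)
pose t := Num.min 1 (d / 2 / (e *+ 2 + 1)).
have t0 : 0 < t by rewrite lt_min ltr01 !divr_gt0.
have tt : (e + t) ^+ 2 <= e ^+ 2 + d / 2.
  have t1 : t <= 1 by rewrite ge_min lexx.
  have : t * (e *+ 2 + 1) <= d / 2 by rewrite -ler_pdivlMr// ge_min lexx orbT.
  have : t * t <= t by rewrite ger_pMl.
  rewrite !mulr2n expr2; nra.
have d2 : 0 < d / 2 by rewrite divr_gt0.
have [N1 h1] := u_le _ t0; have [N2 h2] := completion_dotP hu hu d2.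
have := h2 _ (leq_maxr N1 N2); have := h1 _ (leq_maxl N1 N2).
set n := maxn _ _ => un dn.
have un2 : B (u n) (u n) <= ((e + t) ^+ 2)%:C.
  by rewrite -snorm2 rmorphXn lerXn2r ?nnegrE ?snorm_ge0// ler0c addr_ge0// ltW.
have := le_lt_trans (complex_dist_Re _ _) dn; rewrite ltcR => {}dn.
have {}un2 : complex.Re (B (u n) (u n)) <= (e + t) ^+ 2.
  by move: un2; rewrite lecE /= => /andP[].
have := ler_norm (complex.Re (completion_dot phi phi) - complex.Re (B (u n) (u n))).
rewrite distrC; lra.
Qed.

(** The functionals [B (v n)] converge pointwise by completeness of the complex plane; letting [m]
    grow in the Cauchy estimate makes the convergence uniform relative to [snorm B]. *)
Lemma cauchy_embed (v : nat -> V) :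
  (forall e : R, 0 < e -> exists N, forall n m, (N <= n)%N -> (N <= m)%N ->
    snorm B (v n - v m) <= e%:C) ->
  exists phi, approx phi v.
Proof.
move=> vC.
have lim x : exists l, null_seq (fun n => B (v n) x - l).
  apply: cauchy_null_seq => e e0.
  have [s0 sE] : 0 < complex.Re (snorm B x + 1) /\
      snorm B x + 1 = (complex.Re (snorm B x + 1))%:C.
    by apply: gt0_complexE; rewrite ltr_wpDl// snorm_ge0.
  have [N h] := vC _ (divr_gt0 e0 s0); exists N => n m Nn Nm.
  rewrite -sdotBl (le_lt_trans (sdot_CauchySchwarz _ _ _))//.
  have e0' : 0 < (e / complex.Re (snorm B x + 1))%:C by rewrite ltcR divr_gt0.
  apply: (@lt_le_trans _ _ ((e / complex.Re (snorm B x + 1))%:C * (snorm B x + 1))).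
    rewrite (le_lt_trans (ler_wpM2r (snorm_ge0 _ _) (h _ _ Nn Nm)))//.
    by rewrite ltr_pM2l// ltrDl.
  by rewrite sE -rmorphM /= divfK// gt_eqF.
have [f hf] := choice lim.
have bound e : 0 < e -> exists N, forall n, (N <= n)%N ->
    forall x, `|f x - B (v n) x| <= e%:C * snorm B x.
  move=> e0; have [N h] := vC _ e0; exists N => n Nn x.
  have sr : snorm B x = (complex.Re (snorm B x))%:C.
    by rewrite RRe_real// ger0_real// snorm_ge0.
  have nr : `|f x - B (v n) x| = (complex.Re `|f x - B (v n) x|)%:C.
    by rewrite RRe_real// normr_real.
  rewrite nr sr -rmorphM lecR.
  apply/ler_addgt0Pr => d d0; have [N' h'] := hf x _ d0.
  rewrite -lecR -nr.
  have := h' _ (leq_maxr N N'); have := h _ _ (leq_maxl N N') Nn.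
  set m := maxn _ _ => hm hd.
  have -> : f x - B (v n) x = B (v m - v n) x - (B (v m) x - f x).
    by rewrite sdotBl; ring.
  rewrite (le_trans (ler_normB _ _))// rmorphD lerD// ?(ltW hd)//.
  rewrite (le_trans (sdot_CauchySchwarz _ _ _))// rmorphM /= -sr.
  by rewrite ler_wpM2r// snorm_ge0.
have f_app : (f : V -> R[i]^o) \in approximable B.
  by apply/asboolP => e /bound[N /(_ N (leqnn N))]; exists (v N).
by exists (Completion f_app).
Qed.

Lemma completion_norm0 phi : cnorm phi = 0 -> phi = 0.
Proof.
move=> phi0; apply: completion_ext => x; apply/eqP; rewrite -normr_eq0 eq_le normr_ge0.
by rewrite andbT (le_trans (cval_le _ _))// phi0 mul0r.
Qed.

HB.instance Definition _ := Lmodule_isNormed.Build R[i] (completion B)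
  (snormD completion_semi_dot) (snormZ completion_semi_dot) completion_norm0.

End CompletionDot.

(** * Completeness, inner product and extension of operators *)

Section CompletionHilbert.
Variables (R : realType) (V : lmodType R[i]) (B : semi_dot V).

Lemma completion_normE (phi : completion B) : `|phi| = snorm (completion_semi_dot B) phi.
Proof. by []. Qed.

(** The filter is traced by centres of balls of radius [1 / (n + 1)] belonging to it, and the
    centres by embedded vectors. These form a Cauchy sequence, whose limit is the limit of the
    filter. *)
Lemma completion_cauchy_cvg (F : set_system (completion B)) :
  ProperFilter F -> cauchy F -> cvg F.
Proof.
move=> FF FC.
pose r n : R := n.+1%:R^-1.
have r0 n : 0 < r n by rewrite invr_gt0.
have ballF n : exists phi, F (ball phi (r n)%:C).
  have rn : 0 < (r n)%:C :> R[i] by rewrite ltcR.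
  by have /cauchyP/(_ _ rn) := FC.
have [phi hphi] := choice ballF.
have near_v n : exists x, `|phi n - embed B x| <= (r n)%:C.
  have [x hx] := cvalP (phi n) (r0 n); exists x; rewrite completion_normE.
  by apply: cnorm_le => [|y]; [exact: ltW|rewrite cvalD cvalN embedE; exact: hx].
have [v hv] := choice near_v.
(* Two balls belonging to a proper filter meet. *)
have phi_dist n m : `|phi n - phi m| <= (r n + r m)%:C.
  have [psi [/= hn hm]] := @filter_ex _ F _ _ (filterI (hphi n) (hphi m)).
  rewrite -ball_normE /= in hn hm; rewrite -[phi n](subrK psi) -addrA.
  by rewrite (le_trans (ler_normD _ _))// rmorphD lerD ?(ltW hn)// distrC ltW.
have small e : 0 < e -> exists N, forall n, (N <= n)%N -> r n <= e.
  move=> e0; exists (Num.trunc e^-1) => n Nn.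
  rewrite invf_ple ?posrE// ltW// (lt_le_trans (truncnS_gt _))// ler_nat.
  by rewrite ltnS.
have [|psi hpsi] := @cauchy_embed R V B v.
  move=> e e0; have e4 : 0 < e / 4 by rewrite divr_gt0.
  have [N hN] := small _ e4; exists N => n m /hN rn /hN rm.
  rewrite -cnorm_embed.
  have -> : embed B (v n - v m) = (embed B (v n) - phi n) + (phi n - phi m) +
      (phi m - embed B (v m)).
    rewrite [embed B (v n) - _ + _]addrA subrK addrA subrK.
    by apply: completion_ext => x; rewrite cvalD cvalN !embedE sdotBl.
  rewrite -completion_normE (le_trans (ler_normD _ _))//.
  rewrite (le_trans (lerD (ler_normD _ _) (hv m)))// distrC.
  rewrite (le_trans (lerD (lerD (hv n) (phi_dist n m)) (lexx _)))//.
  rewrite -!rmorphD lecR /=; lra.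
apply/cvg_ex; exists psi; apply/cvgrPdist_le => e /gt0_complexE[e0 ->].
have e4 : 0 < complex.Re e / 4 by rewrite divr_gt0.
have [N1 h1] := hpsi _ e4; have [N2 h2] := small _ e4.
set n := maxn N1 N2.
have {}h1 := h1 n (leq_maxl _ _); have {}h2 := h2 n (leq_maxr _ _).
have psi_v : `|psi - embed B (v n)| <= (complex.Re e / 4)%:C.
  rewrite completion_normE.
  by apply: cnorm_le => [|y]; [exact: ltW|rewrite cvalD cvalN embedE; exact: h1].
apply: filterS (hphi n) => chi; rewrite -ball_normE /= => hchi.
have -> : psi - chi = (psi - embed B (v n)) + (embed B (v n) - phi n) + (phi n - chi).
  by rewrite !subrKA.
rewrite (le_trans (ler_normD _ _))// (le_trans (lerD (ler_normD _ _) (ltW hchi)))//.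
have hv' : `|embed B (v n) - phi n| <= (r n)%:C by rewrite distrC; exact: hv.
rewrite (le_trans (lerD (lerD psi_v hv') (lexx _)))//.
rewrite -!rmorphD lecR /=; lra.
Qed.

HB.instance Definition _ := Uniform_isComplete.Build (completion B) completion_cauchy_cvg.

Definition completion_ip (phi psi : completion B) : R[i] := completion_dot phi psi.

Lemma completion_ip_bilinear : bilinear_for
  (GRing.Scale.Law.clone _ _ *%R _) (GRing.Scale.Law.clone _ _ (Num.conj \; *%R) _)
  completion_ip.
Proof.
split=> [psi|phi] a x y /=; first exact: completion_dot_linear.
rewrite /completion_ip completion_dotC completion_dot_linear rmorphD rmorphM /=.
by rewrite -!completion_dotC.
Qed.

HB.instance Definition _ := bilinear_isBilinear.Build R[i] (completion B) (completion B)
  R[i] _ _ completion_ip completion_ip_bilinear.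

Lemma completion_ip_hermitian phi psi :
  completion_ip phi psi = (-1) ^+ false * Num.conj (completion_ip psi phi).
Proof. by rewrite expr0 mul1r /completion_ip completion_dotC. Qed.

HB.instance Definition _ := isHermitianSesquilinear.Build R[i] (completion B)
  false Num.conj completion_ip completion_ip_hermitian.

Lemma completion_ip_gt0 phi : phi != 0 -> 0 < completion_ip phi phi.
Proof.
move=> phi0; have := snorm2 (completion_semi_dot B) phi.
rewrite /completion_ip => /= <-; rewrite exprn_gt0// lt_def snorm_ge0 andbT.
by apply: contra_neq phi0; exact: completion_norm0.
Qed.

HB.instance Definition _ := isDotProduct.Build R[i] (completion B)
  completion_ip completion_ip_gt0.

Definition completion_inner_product : {dot (completion B) for (@Num.conj R[i])} :=
  completion_ip.

Lemma completion_inner_productE phi : `|phi| ^+ 2 = completion_inner_product phi phi.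
Proof. exact: snorm2. Qed.

Variable S : V -> V.
Hypothesis S_le : forall x, snorm B (S x) <= snorm B x.
Variable S' : V -> V.
Hypothesis S_adj : forall x y, B (S' x) y = B x (S y).

(** Precomposition with [S] extends [S'] to the completion: it sends [embed x] to [embed (S' x)]. *)
Definition adjoint_shift (phi : completion B) : completion B.
Proof.
exists ((phi : V -> R[i]^o) \o S); apply/asboolP => e e0.
have [x hx] := cvalP phi e0; exists (S' x) => y /=.
by rewrite S_adj (le_trans (hx _))// ler_wpM2l// ler0c ltW.
Defined.

Lemma adjoint_shift_linear : linear adjoint_shift.
Proof. by move=> a phi psi; apply: completion_ext. Qed.

HB.instance Definition _ := GRing.isLinear.Build _ _ _ _ adjoint_shift adjoint_shift_linear.

Lemma adjoint_shift_le phi : `|adjoint_shift phi| <= `|phi|.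
Proof.
have nr : `|phi| = (complex.Re `|phi|)%:C by rewrite RRe_real// normr_real.
have n0 : 0 <= complex.Re `|phi| by rewrite -ler0c -nr.
rewrite nr completion_normE; apply: cnorm_le => // x.
rewrite -nr; apply: le_trans (cval_le phi (S x)) _.
by rewrite ler_wpM2l// snorm_ge0.
Qed.

Lemma iter_adjoint_shift n phi x : iter n adjoint_shift phi x = phi (iter n S x).
Proof. by elim: n x => //= n IH x; rewrite [LHS]IH -iterSr iterS. Qed.

End CompletionHilbert.

(** * The space of square-integrable functions on the circle *)

Section ComplexIntegral.
Variables (R : realType) (mu : probability (borel_circle R) R).

(** Bounded functions are closed under products and integrable; their completion for the inner
    product below is [L^2(mu)]. *)
Definition bounded_measurable (f : borel_circle R -> R[i]) :=
  [/\ measurable_fun setT (fun z => complex.Re (f z)),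
      measurable_fun setT (fun z => complex.Im (f z)) &
      exists M : R, forall z, `|f z| <= M%:C].

Lemma bounded_measurable_lin (a : R[i]) f g :
  bounded_measurable f -> bounded_measurable g ->
  bounded_measurable (fun z => a * f z + g z).
Proof.
move=> [fr fi [M fM]] [gr gi [N gN]]; split.
- rewrite (_ : (fun _ => _) = (fun z => complex.Re a * complex.Re (f z) -
      complex.Im a * complex.Im (f z) + complex.Re (g z))).
    by apply: measurable_funD => //; apply: measurable_funB; apply: measurable_funM.
  by apply/funext => z; case: a (f z) (g z) => ? ? [? ?] [? ?].
- rewrite (_ : (fun _ => _) = (fun z => complex.Re a * complex.Im (f z) +
      complex.Im a * complex.Re (f z) + complex.Im (g z))).
    by apply: measurable_funD => //; apply: measurable_funD; apply: measurable_funM.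
  by apply/funext => z; case: a (f z) (g z) => ? ? [? ?] [? ?].
- have aE : `|a| = (complex.Re `|a|)%:C by rewrite RRe_real// normr_real.
  exists (complex.Re `|a| * M + N) => z; rewrite rmorphD rmorphM /= -aE.
  by rewrite (le_trans (ler_normD _ _))// lerD// normrM ler_wpM2l.
Qed.

Lemma bounded_measurableM f g :
  bounded_measurable f -> bounded_measurable g ->
  bounded_measurable (fun z => f z * g z).
Proof.
move=> [fr fi [M fM]] [gr gi [N gN]]; split.
- rewrite (_ : (fun _ => _) = (fun z => complex.Re (f z) * complex.Re (g z) -
      complex.Im (f z) * complex.Im (g z))).
    by apply: measurable_funB; apply: measurable_funM.
  by apply/funext => z; case: (f z) (g z) => ? ? [? ?].
- rewrite (_ : (fun _ => _) = (fun z => complex.Re (f z) * complex.Im (g z) +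
      complex.Im (f z) * complex.Re (g z))).
    by apply: measurable_funD; apply: measurable_funM.
  by apply/funext => z; case: (f z) (g z) => ? ? [? ?].
- by exists (M * N) => z; rewrite rmorphM normrM ler_pM.
Qed.

Lemma bounded_measurable_conj f :
  bounded_measurable f -> bounded_measurable (fun z => Num.conj (f z)).
Proof.
move=> [fr fi [M fM]]; split.
- rewrite (_ : (fun _ => _) = (fun z => complex.Re (f z)))//.
  by apply/funext => z; case: (f z).
- rewrite (_ : (fun _ => _) = (fun z => - complex.Im (f z))).
    exact: measurable_funN.
  by apply/funext => z; case: (f z).
- by exists M => z; rewrite norm_conjC.
Qed.

Lemma bounded_measurable_cst a : bounded_measurable (fun _ => a).
Proof.
split; [exact: measurable_cst|exact: measurable_cst|].
by exists (complex.Re `|a|) => z; rewrite RRe_real// normr_real.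
Qed.

Lemma bounded_measurable_circle_val : bounded_measurable (@circle_val R).
Proof.
split; [exact: measurable_Re_circle_val|exact: measurable_Im_circle_val|].
by exists 1 => z; rewrite norm_circle_val.
Qed.

Lemma bounded_measurable_integrable f : bounded_measurable f ->
  mu.-integrable setT (EFin \o (fun z => complex.Re (f z))) /\
  mu.-integrable setT (EFin \o (fun z => complex.Im (f z))).
Proof.
move=> [fr fi [M fM]].
have Re1 (z : R[i]) : `|complex.Re z|%:C <= `|z|.
  by have := complex_dist_Re z 0; rewrite !subr0.
have Im1 (z : R[i]) : `|complex.Im z|%:C <= `|z|.
  by have := complex_dist_Im z 0; rewrite !subr0.
split; apply: (@bounded_integrable _ _ _ _ _ M) => // z; rewrite -lecR.
  exact: le_trans (Re1 _) (fM z).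
exact: le_trans (Im1 _) (fM z).
Qed.

Definition cintegral (f : borel_circle R -> R[i]) : R[i] :=
  (\int[mu]_z complex.Re (f z)) +i* (\int[mu]_z complex.Im (f z)).

Lemma cintegral_lin (a : R[i]) f g :
  bounded_measurable f -> bounded_measurable g ->
  cintegral (fun z => a * f z + g z) = a * cintegral f + cintegral g.
Proof.
move=> /bounded_measurable_integrable[fr fi] /bounded_measurable_integrable[gr gi].
have intZ (r : R) h : mu.-integrable setT (EFin \o h) ->
    mu.-integrable setT (EFin \o (fun z => r * h z)).
  by move=> ih; have := integrableZl measurableT r ih.
case: a => a b; rewrite /cintegral.
have -> : \int[mu]_z complex.Re ((a +i* b) * f z + g z) =
    a * \int[mu]_z complex.Re (f z) - b * \int[mu]_z complex.Im (f z) +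
    \int[mu]_z complex.Re (g z).
  rewrite -!RintegralZl// -RintegralB//; [|exact: intZ|exact: intZ].
  rewrite -RintegralD//.
    by apply: eq_Rintegral => z _; case: (f z) (g z) => ? ? [? ?].
  by have := integrableB measurableT (intZ a _ fr) (intZ b _ fi).
have -> : \int[mu]_z complex.Im ((a +i* b) * f z + g z) =
    a * \int[mu]_z complex.Im (f z) + b * \int[mu]_z complex.Re (f z) +
    \int[mu]_z complex.Im (g z).
  rewrite -!RintegralZl// -RintegralD//; [|exact: intZ|exact: intZ].
  rewrite -RintegralD//.
    by apply: eq_Rintegral => z _; case: (f z) (g z) => ? ? [? ?].
  by have := integrableD measurableT (intZ a _ fi) (intZ b _ fr).
by [].
Qed.

Lemma cintegral_conj f : bounded_measurable f ->
  cintegral (fun z => Num.conj (f z)) = Num.conj (cintegral f).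
Proof.
move=> /bounded_measurable_integrable[fr fi].
rewrite /cintegral; apply/eqP; rewrite eq_complex /=; apply/andP; split; apply/eqP.
  by apply: eq_Rintegral => z _; case: (f z).
rewrite -mulN1r -RintegralZl//.
by apply: eq_Rintegral => z _; rewrite mulN1r; case: (f z).
Qed.

Lemma cintegral_ge0 f : (forall z, 0 <= f z) -> 0 <= cintegral f.
Proof.
move=> f0; have fi z : complex.Im (f z) = 0 by exact: ger0_Im.
rewrite /cintegral lecE /=; apply/andP; split.
  under eq_Rintegral do rewrite fi.
  by rewrite Rintegral_cst// mul0r.
by apply: Rintegral_ge0 => z _; have := f0 z; rewrite lecE => /andP[].
Qed.

Definition bm_pred : {pred borel_circle R -> R[i]^o} := fun f => `[< bounded_measurable f >].

Lemma bm_submod : submod_closed bm_pred.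
Proof.
split=> [|a f g /asboolP hf /asboolP hg]; apply/asboolP.
  exact: bounded_measurable_cst.
exact: bounded_measurable_lin.
Qed.

HB.instance Definition _ :=
  GRing.isSubmodClosed.Build R[i] (borel_circle R -> R[i]^o) bm_pred bm_submod.

End ComplexIntegral.

Record bmfun (R : realType) := BMFun {
  bmval :> borel_circle R -> R[i]^o; _ : bmval \in @bm_pred R }.

HB.instance Definition _ (R : realType) := [isSub for @bmval R].
HB.instance Definition _ (R : realType) := [Choice of bmfun R by <:].
HB.instance Definition _ (R : realType) := [SubChoice_isSubLmodule of bmfun R by <:].

Section CircleDot.
Variables (R : realType) (mu : probability (borel_circle R) R).

Lemma bmfunP (f : bmfun R) : bounded_measurable f.
Proof. by case: f => f /= /asboolP. Qed.

Definition mk_bmfun (f : borel_circle R -> R[i]) (hf : bounded_measurable f) : bmfun R :=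
  BMFun (asboolT hf : (f : borel_circle R -> R[i]^o) \in @bm_pred R).

Definition circle_dot (f g : bmfun R) : R[i] :=
  cintegral mu (fun z => f z * Num.conj (g z)).

Let bm_prod (f g : bmfun R) : bounded_measurable (fun z => f z * Num.conj (g z)).
Proof.
by apply: bounded_measurableM (bmfunP f) _; apply: bounded_measurable_conj (bmfunP g).
Qed.

Lemma circle_dotP a f g h : circle_dot (a *: f + g) h = a * circle_dot f h + circle_dot g h.
Proof.
rewrite /circle_dot -cintegral_lin; [|exact: bm_prod|exact: bm_prod].
congr cintegral; apply/funext => z.
have -> : (a *: f + g) z = a * f z + g z by [].
by rewrite mulrDl mulrA.
Qed.

Lemma circle_dotC f g : circle_dot f g = Num.conj (circle_dot g f).
Proof.
rewrite /circle_dot -cintegral_conj; last exact: bm_prod.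
by congr cintegral; apply/funext => z; rewrite rmorphM /= conjCK mulrC.
Qed.

Lemma circle_dot_ge0 f : 0 <= circle_dot f f.
Proof. by apply: cintegral_ge0 => z; rewrite -normCK exprn_ge0. Qed.

Definition circle_semi_dot : semi_dot (bmfun R) :=
  SemiDot circle_dotP circle_dotC circle_dot_ge0.

Definition bm_shift (f : bmfun R) : bmfun R :=
  mk_bmfun (bounded_measurableM (@bounded_measurable_circle_val R) (bmfunP f)).

Definition bm_unshift (f : bmfun R) : bmfun R :=
  mk_bmfun (bounded_measurableM
    (bounded_measurable_conj (@bounded_measurable_circle_val R)) (bmfunP f)).

Lemma circle_dot_adjoint f g : circle_dot (bm_shift f) g = circle_dot f (bm_unshift g).
Proof.
congr cintegral; apply/funext => z /=.
by rewrite rmorphM /= conjCK; ring.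
Qed.

Lemma snorm_unshift f : snorm circle_semi_dot (bm_unshift f) = snorm circle_semi_dot f.
Proof.
rewrite /snorm; congr sqrtC; congr cintegral; apply/funext => z /=.
by rewrite -!normCK normrM norm_conjC norm_circle_val mul1r.
Qed.

End CircleDot.

(** The integral is that of the squared distance to [a]. If it vanishes, the complement of [a] lies
    in a null set, so a measurable set has measure 1 or 0 according to whether it contains [a]. *)
Lemma is_dirac_sqr_dist (R : realType) (mu : probability (borel_circle R) R)
    (a : borel_circle R) :
  cintegral mu (fun z => (circle_val z - circle_val a) *
    Num.conj (circle_val z - circle_val a)) = 0 -> is_dirac mu.
Proof.
move=> int0; exists a => A mA; pose l := circle_val a.
pose d z := circle_val z - l.
have d_bm : bounded_measurable d.
  have := bounded_measurable_lin 1 (@bounded_measurable_circle_val R)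
    (bounded_measurable_cst (R := R) (- l)).
  by rewrite (_ : (fun _ => _) = d)//; apply/funext => z; rewrite mul1r.
have sqr_bm := bounded_measurableM d_bm (bounded_measurable_conj d_bm).
pose f z := complex.Re (d z * Num.conj (d z)).
have fE z : `|d z| ^+ 2 = (f z)%:C.
  by rewrite /f -normCK RRe_real// rpredX// normr_real.
have f0 z : 0 <= f z by rewrite -ler0c -fE exprn_ge0.
have [mf _ _] := sqr_bm; have [intf _] := bounded_measurable_integrable mu sqr_bm.
have : (\int[mu]_z (f z)%:E = 0)%E.
  have int_fin : (\int[mu]_z (f z)%:E)%E \is a fin_num by exact: integrable_fin_num.
  rewrite -(fineK int_fin); congr (_%:E); by case: int0.
have -> : (\int[mu]_z (f z)%:E = \int[mu]_z `|(f z)%:E|)%E.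
  by apply: eq_integral => z _; rewrite gee0_abs// lee_fin.
have mEf : measurable_fun setT (EFin \o f) by exact/measurable_EFinP.
move=> /(ae_eq_integral_abs mu measurableT mEf)[N [mN muN0 fN]].
have val_inj' z : circle_val z = l -> z = a by exact: val_inj.
have notin z : z <> a -> N z.
  move=> za; apply: fN => /(_ I) /= [] fz; apply/za/val_inj'/eqP.
  by rewrite -subr_eq0 -normr_eq0 -sqrf_eq0 fE fz.
have null (C : set (borel_circle R)) : measurable C -> ~ C a -> mu C = 0%E.
  move=> mC Ca; apply/eqP; rewrite -measure_le0 -muN0.
  by apply: le_measure; rewrite ?inE// => z Cz; apply: notin => za; rewrite za in Cz.
rewrite diracE; have [aA|aA] := boolP (a \in A).
  have : mu (~` A) = 0%E.
    by apply: null; [exact: measurableC|move=> /(_ (set_mem aA))].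
  rewrite probability_setC// => /eqP; rewrite sube_eq//.
  by rewrite add0e => /eqP <-.
by apply: null => // /mem_set; exact/negP.
Qed.

Lemma hilbert_property_extremal (R : realType) (k : nat -> nat) :
  hilbert_property R k -> extremal R k.
Proof.
move=> hil mu mu1; pose B := circle_semi_dot mu.
pose one : bmfun R := mk_bmfun (bounded_measurable_cst (R := R) 1).
pose ip := completion_inner_product B.
have S_le f : snorm B (bm_unshift f) <= snorm B f by rewrite snorm_unshift.
(* Precomposition with multiplication by the conjugate of [z], that is, multiplication by [z] on
   [L^2(mu)]. *)
pose T := adjoint_shift S_le (@circle_dot_adjoint R mu).
pose x := embed B one.
have muT : fine (mu setT) = 1 := congr1 fine (probability_setT mu).
have xx : ip x x = 1.
  rewrite [LHS]completion_dot_embed embedE /= /circle_dot /cintegral.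
  have -> : \int[mu]_z complex.Re (1 * Num.conj (1 : R[i])) = 1.
    by rewrite rmorph1 mulr1 Rintegral_cst// mul1r muT.
  have -> : \int[mu]_z complex.Im (1 * Num.conj (1 : R[i])) = 0.
    by rewrite rmorph1 mulr1 Rintegral_cst// mul0r.
  by [].
have x1 : `|x| ^+ 2 = 1 by rewrite completion_inner_productE.
have x0 : x != 0 by rewrite -normr_eq0 -sqrf_eq0 x1 oner_eq0.
have unshiftE n z : iter n (@bm_unshift R) one z = Num.conj (circle_val z ^+ n).
  elim: n => [|n IH]; first by rewrite expr0 rmorph1.
  by rewrite iterS exprS rmorphM /= -IH.
have coef n : ip (iter n T x) x = fourier_coef mu n.
  rewrite [LHS]completion_dot_embed iter_adjoint_shift embedE /= /circle_dot.
  rewrite /cintegral /fourier_coef; congr (_ +i* _); apply: eq_Rintegral => z _;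
    by rewrite unshiftE conjCK mul1r.
have kc : (fun n => `|ip (iter (k n) T x) x| : R[i]^o) @ \oo --> (`|x| ^+ 2 : R[i]^o).
  rewrite x1.
  have -> : (fun n => `|ip (iter (k n) T x) x| : R[i]^o) =
      (fun n => `|fourier_coef mu (k n)|) by apply/funext => n; rewrite coef.
  exact: mu1.
have [_ [l [l1 Tx]]] := hil _ ip (completion_inner_productE (B := B)) T
  (adjoint_shift_le S_le (@circle_dot_adjoint R mu)) x x0 kc.
pose a : borel_circle R := SigSub (mem_set l1 : l \in @unit_circle R).
(* The function [z - l]. The eigenvalue equation [T x = l *: x], evaluated at [w] itself, says that
   its squared length is 0. *)
pose w : bmfun R := bm_shift one - l *: one.
apply: (@is_dirac_sqr_dist R mu a).
have : B w w = 0.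
  rewrite {1}/w sdotBl sdotZl; apply/eqP; rewrite subr_eq0; apply/eqP.
  transitivity ((l *: x) w); last by [].
  by rewrite -Tx; exact: circle_dot_adjoint.
rewrite /B /= /circle_dot; congr (_ = _); congr cintegral; apply/funext => z.
have -> : w z = circle_val z - circle_val a; last by [].
have -> : w z = circle_val z * 1 - l * 1 by [].
by rewrite !mulr1.
Qed.

Theorem theorem5p9 (R : realType) (k : nat -> nat) (hk : subsequence k) :
  (extremal R k <-> hilbert_property R k) /\
  ((0 < upper_density R k)%E -> (liminf_gap R k < +oo)%E) /\
  ((liminf_gap R k < +oo)%E ->
    (extremal R k <-> banach_property R k) /\
    (hilbert_property R k <-> banach_property R k)).
Proof.
have EH : extremal R k <-> hilbert_property R k.
  by split; [exact: extremal_hilbert_property|exact: hilbert_property_extremal].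
split=> //; split; first exact: upper_density_gt0_liminf_gap.
move=> gap; have EB : extremal R k <-> banach_property R k.
  split; first exact: extremal_banach_property.
  by move=> /banach_hilbert_property /hilbert_property_extremal.
by split=> //; rewrite -EH.
Qed.
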